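(* Let $u\in\mathbb{K}$ be the minimizer of $J(v)=\frac12\int_\Omega|\nabla v|^2\,dx$ over $\mathbb{K}$. Then for every $v\in\mathbb{K}$, every $\lambda\in\Lambda$ and every $q^*\in H(\Omega_\pm,\mathrm{div})$, $$\begin{aligned}\|\nabla(v-u)\|_\Omega\le{}&\|\nabla v-q^*\|_\Omega+\sqrt2\Big(\int_{\mathcal{M}}\lambda(v-\psi)\,d\mu\Big)^{1/2}\\&+C_{F_{\Omega_+}}\|\mathrm{div}\,q^*\|_{\Omega_+}+C_{F_{\Omega_-}}\|\mathrm{div}\,q^*\|_{\Omega_-}+C_{Tr_{\mathcal{M}}}\|\lambda-[q^*\cdot\mathbf{n}]\|_{\mathcal{M}}.\end{aligned}$$
   Context: $\Omega\subset\mathbb{R}^n$ is open, connected and bounded with Lipschitz continuous boundary $\partial\Omega$; $\mathcal{M}$ is a smooth $(n-1)$-dimensional manifold in $\mathbb{R}^n$ which divides $\Omega$ into two Lipschitz subdomains $\Omega_+$ and $\Omega_-$. Integrals over $\mathcal{M}$ (with surface measure $d\mu$) and the space $L^2(\mathcal{M})$ refer to the part of $\mathcal{M}$ in $\Omega$; values of Sobolev functions on $\mathcal{M}$ and $\partial\Omega$ are traces. $\|\cdot\|_\omega$ denotes the $L^2(\omega)$ norm of scalar or vector-valued functions. The obstacle $\psi:\mathcal{M}\to\mathbb{R}$ is smooth, the boundary datum is $\varphi\in H^{1/2}(\partial\Omega)$, and $\varphi\ge\psi$ on $\mathcal{M}\cap\partial\Omega$. Admissible set: $\mathbb{K}=\{v\in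 H^1(\Omega): v\ge\psi\text{ on }\mathcal{M}\cap\Omega,\ v=\varphi\text{ on }\partial\Omega\}$; it is known that $J$ has a unique minimizer $u$ over $\mathbb{K}$ (the thin obstacle problem). $\Lambda=\{\lambda\in L^2(\mathcal{M}):\lambda\ge0\text{ a.e. on }\mathcal{M}\}$. $H(\Omega_\pm,\mathrm{div})=\{q^*\in L^2(\Omega,\mathbb{R}^n):\mathrm{div}(q^*|_{\Omega_\pm})\in L^2(\Omega_\pm)\text{ (for both signs)},\ [q^*\cdot\mathbf{n}]\in L^2(\mathcal{M})\}$, where $[q^*\cdot\mathbf{n}]=q^*|_{\Omega_+}\cdot\mathbf{n}_++q^*|_{\Omega_-}\cdot\mathbf{n}_-$ is the jump of the normal component across $\mathcal{M}$, $\mathbf{n}_\pm$ being the outer unit normals to $\Omega_\pm$ on $\mathcal{M}$ (understood in the generalized sense, via integration by parts against $w\in H^1_0(\Omega)$); $\|\mathrm{div}\,q^*\|_{\Omega_\pm}$ means the norm of $\mathrm{div}(q^*|_{\Omega_\pm})$. Constants: $C_{F_{\Omega_\pm}}$ are constants in the Friedrichs type inequalities $\|w\|_{\Omega_\pm}\le C_{F_{\Omega_\pm}}\|\nabla w\|_{\Omega_\pm}$, and $C_{Tr_{\mathcal{M}}}=\min\{C_{Tr_{\mathcal{M}}}(\Omega_+),C_{Tr_{\mathcal{M}}}(\Omega_-)\}$, where $C_{Tr_{\mathcal{M}}}(\Omega_\pm)$ are constants in the trace inequalities $\|w\|_{\mathcal{M}}\le C_{Tr_{\mathcal{M}}}(\Omega_\pm)\|\nabla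 w\|_{\Omega_\pm}$; all these inequalities are assumed to hold for all $w\in H^1_0(\Omega)$. *)

(* Defs.v *)
From HB Require Import structures.
From mathcomp Require Import all_boot all_order all_algebra.
From mathcomp Require Import all_classical all_reals all_analysis.
Set Implicit Arguments.
Unset Strict Implicit.
Unset Printing Implicit Defensive.
Import Order.TTheory GRing.Theory Num.Theory.
Import numFieldNormedType.Exports.

Local Open Scope classical_set_scope.
Local Open Scope ring_scope.

(* The library norm on 'rV[R]_n is the max norm: it yields the usual topology,
   but lengths have to be measured with [enorm]. *)
Definition enorm (R : realType) (n : nat) (x : 'rV[R]_n) : R :=
  Num.sqrt (\sum_(i < n) x 0 i ^+ 2).

Definition dotv (R : realType) (n : nat) (x y : 'rV[R]_n) : R :=
  \sum_(i < n) x 0 i * y 0 i.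

Arguments enorm {R n} x.
Arguments dotv {R n} x y.

Section lebesgue_Rn.
Context (R : realType) (n : nat).
Local Notation borelRn := (g_sigma_algebraType (@open 'rV[R]_n)).
Local Open Scope ereal_scope.

Definition closed_box (a b : 'rV[R]_n) : set 'rV[R]_n :=
  [set x | forall i, (a 0 i <= x 0 i <= b 0 i)%R].

Definition box_volume (a b : 'rV[R]_n) : R := (\prod_(i < n) (b 0 i - a 0 i))%R.

(* +oo (the infimum of the empty set) on nonempty sets that are not boxes *)
Definition box_gauge (A : set borelRn) : \bar R :=
  if A == set0 then 0 else
  ereal_inf [set (box_volume c.1 c.2)%:E | c in
             [set c | A = closed_box c.1 c.2]].

Lemma box_gauge0 : box_gauge set0 = 0.
Proof. by rewrite /box_gauge eqxx. Qed.

Lemma box_gauge_ge0 A : 0 <= box_gauge A.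
Proof.
rewrite /box_gauge; case: eqVneq => // /set0P[x Ax].
apply: le_ereal_inf_tmp => _ [[a b] /= Aab] <-.
rewrite lee_fin prodr_ge0// => i _.
by move: Ax; rewrite Aab => /(_ i)/andP[ax xb]; rewrite subr_ge0 (le_trans ax).
Qed.

(* inf of the total volume over countable coverings by boxes *)
Definition lebesgue_outer (A : set 'rV[R]_n) : \bar R :=
  mu_ext box_gauge (A : set borelRn).

Lemma lebesgue_outer0 : lebesgue_outer set0 = 0.
Proof. exact: mu_ext0 box_gauge0 box_gauge_ge0. Qed.

Lemma lebesgue_outer_ge0 A : 0 <= lebesgue_outer A.
Proof. exact: mu_ext_ge0 box_gauge_ge0 _. Qed.

Lemma le_lebesgue_outer : {homo lebesgue_outer : A B / A `<=` B >-> A <= B}.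
Proof. exact: (@le_mu_ext _ _ _ box_gauge). Qed.

Lemma lebesgue_outer_sigma_subadditive : sigma_subadditive lebesgue_outer.
Proof. exact: (mu_ext_sigma_subadditive box_gauge_ge0). Qed.

HB.instance Definition _ := isOuterMeasure.Build R 'rV[R]_n lebesgue_outer
  lebesgue_outer0 lebesgue_outer_ge0 le_lebesgue_outer
  lebesgue_outer_sigma_subadditive.

End lebesgue_Rn.

Section hausdorff.
Context (R : realType) (n : nat).
Local Notation borelRn := (g_sigma_algebraType (@open 'rV[R]_n)).
Local Open Scope ereal_scope.

Definition diameter (A : set 'rV[R]_n) : \bar R :=
  ereal_sup [set (enorm (p.1 - p.2)%R)%:E | p in A `*` A].

Definition unit_ball_volume (m : nat) : R :=
  fine (lebesgue_outer [set x : 'rV[R]_m | (enorm x <= 1)%R]).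

(* The constant normalizes the m-dimensional Hausdorff measure so that it is the
   m-dimensional surface measure on m-dimensional submanifolds. Coverings by Borel
   sets suffice, because a set and its closure have the same diameter. *)
Definition hausdorff_gauge (m : nat) (delta : R) (A : set borelRn) : \bar R :=
  if A == set0 then 0 else
  if diameter A <= delta%:E
  then (unit_ball_volume m * (fine (diameter A) / 2) ^+ m)%:E else +oo.

Lemma hausdorff_gauge0 m delta : hausdorff_gauge m delta set0 = 0.
Proof. by rewrite /hausdorff_gauge eqxx. Qed.

Lemma hausdorff_gauge_ge0 m delta A : 0 <= hausdorff_gauge m delta A.
Proof.
rewrite /hausdorff_gauge; case: eqVneq => // /set0P[x Ax]; case: ifP => // _.
rewrite lee_fin mulr_ge0 ?exprn_ge0 ?divr_ge0 ?fine_ge0 ?lebesgue_outer_ge0//.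
apply: ereal_sup_ubound; exists (x, x) => //=.
rewrite /enorm subrr big1 ?sqrtr0// => i _.
by rewrite mxE expr0n.
Qed.

Definition hausdorff_delta (m : nat) (delta : R) (A : set 'rV[R]_n) : \bar R :=
  mu_ext (hausdorff_gauge m delta) (A : set borelRn).

Definition hausdorff_outer (m : nat) (A : set 'rV[R]_n) : \bar R :=
  ereal_sup [set hausdorff_delta m delta A | delta in [set delta | (0 < delta)%R]].

Lemma hausdorff_delta_le m delta A :
  (0 < delta)%R -> hausdorff_delta m delta A <= hausdorff_outer m A.
Proof. by move=> d0; apply: ereal_sup_ubound; exists delta. Qed.

Lemma hausdorff_outer0 m : hausdorff_outer m set0 = 0.
Proof.
apply/eqP; rewrite eq_le; apply/andP; split.
  apply: ge_ereal_sup => _ [delta _ <-].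
  by rewrite [leLHS]mu_ext0//; [exact: hausdorff_gauge0
    |exact: hausdorff_gauge_ge0].
apply: le_trans (hausdorff_delta_le m set0 ltr01).
exact/mu_ext_ge0/hausdorff_gauge_ge0.
Qed.

Lemma hausdorff_outer_ge0 m A : 0 <= hausdorff_outer m A.
Proof.
apply: le_trans (hausdorff_delta_le m A ltr01).
exact/mu_ext_ge0/hausdorff_gauge_ge0.
Qed.

Lemma le_hausdorff_outer m :
  {homo hausdorff_outer m : A B / A `<=` B >-> A <= B}.
Proof.
move=> A B AB; apply: ge_ereal_sup => _ [delta d0 <-].
apply: le_trans (hausdorff_delta_le m B d0).
exact: (@le_mu_ext _ _ _ (hausdorff_gauge m delta)).
Qed.

Lemma hausdorff_outer_sigma_subadditive m : sigma_subadditive (hausdorff_outer m).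
Proof.
move=> F; apply: ge_ereal_sup => _ [delta d0 <-].
apply: le_trans (mu_ext_sigma_subadditive (@hausdorff_gauge_ge0 m delta) F) _.
apply: lee_nneseries => i _; last exact: hausdorff_delta_le.
by move=> _; exact/mu_ext_ge0/hausdorff_gauge_ge0.
Qed.

HB.instance Definition _ m := isOuterMeasure.Build R 'rV[R]_n (hausdorff_outer m)
  (hausdorff_outer0 m) (hausdorff_outer_ge0 m) (@le_hausdorff_outer m)
  (@hausdorff_outer_sigma_subadditive m).

End hausdorff.

Arguments lebesgue_outer {R} n _.
Arguments hausdorff_outer {R} n m _.

(* Both measures live on the sigma-algebra of Caratheodory measurable sets of the
   outer measure; for [leb] these are exactly the Lebesgue measurable sets. *)
Definition cara_measure (R : realType) (T : pointedType)
    (mu : {outer_measure set T -> \bar R}) :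
  {measure set (caratheodory_type mu) -> \bar R} :=
  [the measure _ _ of (mu : set (caratheodory_type mu) -> \bar R)].

Definition leb (R : realType) (n : nat) := cara_measure (@lebesgue_outer R n).

(* (n-1)-dimensional surface measure in R^n *)
Definition surf (R : realType) (n : nat) :=
  cara_measure (@hausdorff_outer R n n.-1).

Arguments leb {R n}.
Arguments surf {R n}.

Definition L2 (d : measure_display) (T : measurableType d) (R : realType)
    (mu : {measure set T -> \bar R}) (D : set T) (f : T -> R) : Prop :=
  f \_ D \in Lfun mu 2%:E.

Definition L2norm (d : measure_display) (T : measurableType d) (R : realType)
    (mu : {measure set T -> \bar R}) (D : set T) (f : T -> R) : \bar R :=
  'N[mu]_2%:E [EFin \o (f \_ D)].

Section sobolev.
Context (R : realType) (n : nat).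
Local Notation Rn := 'rV[R]_n.
Implicit Types (D G A : set Rn) (f g : Rn -> R).

Definition L2vec D (q : Rn -> Rn) : Prop :=
  forall i, L2 (@leb R n) D (fun x => q x 0 i).

Definition partial (i : 'I_n) f : Rn -> R :=
  fun x => derive f x (delta_mx 0 i : Rn).

Definition gradient f : Rn -> Rn := fun x => \row_i partial i f x.

Fixpoint Ck (k : nat) f : Prop :=
  continuous f /\
  if k is k'.+1 then
    forall i : 'I_n, (forall x, derivable f x (delta_mx 0 i : Rn)) /\
                     Ck k' (partial i f)
  else True.

Definition smooth f : Prop := forall k, Ck k f.

Definition smooth_on A f : Prop :=
  forall x, A x -> exists2 F, smooth F & \forall y \near x, A y -> f y = F y.

Definition test_function D f : Prop :=
  [/\ smooth f, compact (closure [set x | f x != 0]) &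
      closure [set x | f x != 0] `<=` D].

Definition is_weak_gradient D f (q : Rn -> Rn) : Prop :=
  forall t, test_function D t -> forall i,
    \int[leb]_(x in D) (f x * partial i t x) =
    - \int[leb]_(x in D) (q x 0 i * t x).

Definition is_weak_divergence D (q : Rn -> Rn) f : Prop :=
  forall t, test_function D t ->
    \int[leb]_(x in D) dotv (q x) (gradient t x) =
    - \int[leb]_(x in D) (f x * t x).

(* A representative of an element of H^1(D), bundled with a representative of its
   weak gradient; both matter on D and up to null sets only. *)
Record H1 D := MkH1 {
  H1fun :> Rn -> R ;
  grad : Rn -> Rn ;
  H1fun_L2 : L2 leb D H1fun ;
  grad_L2 : L2vec D grad ;
  gradP : is_weak_gradient D H1fun grad }.

(* [g] is the trace of [w] in L^2(G): the graph of the trace operator, i.e. of the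
   continuous extension of restriction to G from C^oo(closure D) to H^1(D). *)
Definition is_trace D G (w : H1 D) g : Prop :=
  L2 surf G g /\
  exists t : nat -> Rn -> R,
    [/\ forall k, smooth (t k),
        L2norm leb D (fun x => t k x - w x) @[k --> \oo] --> 0%E,
        L2norm leb D (fun x => enorm (gradient (t k) x - grad w x))
          @[k --> \oo] --> 0%E &
        L2norm surf G (fun x => t k x - g x) @[k --> \oo] --> 0%E].

Definition boundary A : set Rn := closure A `\` interior A.

(* H^1_0(D), for a Lipschitz domain D *)
Definition H10 D : set (H1 D) := [set w | is_trace (boundary D) w (cst 0)].

(* H^{1/2} of an (n-1)-dimensional Lipschitz surface (Sobolev-Slobodeckij); the
   exponent of the kernel is (n - 1) + 2 * (1/2) = n. *)
Definition Hhalf G f : Prop :=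
  L2 surf G f /\
  (\int[surf]_(x in G) \int[surf]_(y in G)
     ((f x - f y) ^+ 2 / enorm (x - y) ^+ n)%:E < +oo)%E.

Definition dirichlet_energy D (v : H1 D) : \bar R :=
  ((2^-1)%:E * \int[leb]_(x in D) (enorm (grad v x) ^+ 2)%:E)%E.

End sobolev.

Section geometry.
Context (R : realType) (n : nat).
(* the ambient dimension is n.+1 *)
Local Notation Rn1 := 'rV[R]_n.+1.
Implicit Types D M : set Rn1.

(* Near each boundary point, in suitable orthonormal coordinates z = x *m Q, D is
   the strict epigraph of a Lipschitz function of the first n coordinates. *)
Definition lipschitz_boundary D : Prop :=
  forall x, boundary D x ->
    exists (Q : 'M[R]_n.+1) (gamma : 'rV[R]_n -> R),
      [/\ Q *m Q^T = 1%:M, lipschitz gamma &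
          \forall y \near x,
            D y <-> gamma (col' ord_max (y *m Q)) < (y *m Q) 0 ord_max].

Definition lipschitz_domain D : Prop :=
  [/\ open D, D !=set0, connected D, bounded_set D & lipschitz_boundary D].

Definition smooth_hypersurface M : Prop :=
  forall x, M x -> exists F : Rn1 -> R,
    [/\ smooth F, gradient F x != 0 & \forall y \near x, M y <-> F y = 0].

Definition divides M D Dp Dm : Prop :=
  [/\ lipschitz_domain Dp, lipschitz_domain Dm, Dp `&` Dm = set0,
      D `\` M = Dp `|` Dm & M `&` D `<=` boundary Dp `&` boundary Dm].

End geometry.

Section thin_obstacle.
Context (R : realType) (n : nat).
Local Notation Rn := 'rV[R]_n.
Implicit Types (D Dp Dm M : set Rn) (psi phi : Rn -> R).

Definition admissible D M psi phi : set (H1 D) := [set v |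
  (exists2 g, is_trace (M `&` D) v g &
     {ae surf, forall x, (M `&` D) x -> psi x <= g x}) /\
  is_trace (boundary D) v phi].

Definition minimizer D (K : set (H1 D)) (u : H1 D) : Prop :=
  K u /\ forall v, K v -> (dirichlet_energy u <= dirichlet_energy v)%E.

Definition Lambda D M : set (Rn -> R) := [set l |
  L2 surf (M `&` D) l /\ {ae surf, forall x, (M `&` D) x -> 0 <= l x}].

(* [divplus], [divminus] are the divergences of [flux] on the two sides of M; [jump] is
   the jump of its normal component (with respect to the outer normals of Dp and
   Dm) across M, characterized by integration by parts on Dp and Dm. *)
Record Hdiv D Dp Dm M := MkHdiv {
  flux :> Rn -> Rn ;
  divplus : Rn -> R ;
  divminus : Rn -> R ;
  jump : Rn -> R ;
  flux_L2 : L2vec D flux ;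
  divplus_L2 : L2 leb Dp divplus ;
  divminus_L2 : L2 leb Dm divminus ;
  jump_L2 : L2 surf (M `&` D) jump ;
  divplusP : is_weak_divergence Dp flux divplus ;
  divminusP : is_weak_divergence Dm flux divminus ;
  jumpP : forall (w : H1 D) (g : Rn -> R), H10 w -> is_trace (M `&` D) w g ->
    \int[surf]_(x in M `&` D) (jump x * g x) =
    \int[leb]_(x in D) dotv (flux x) (grad w x)
    + \int[leb]_(x in Dp) (divplus x * w x)
    + \int[leb]_(x in Dm) (divminus x * w x) }.

Definition friedrichs_const D (D' : set Rn) (C : R) : Prop :=
  0 <= C /\ forall w : H1 D, H10 w ->
    (L2norm leb D' w <= C%:E * L2norm leb D' (enorm \o grad w))%E.

Definition trace_const D M (D' : set Rn) (C : R) : Prop :=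
  0 <= C /\ forall (w : H1 D) (g : Rn -> R), H10 w -> is_trace (M `&` D) w g ->
    (L2norm surf (M `&` D) g <= C%:E * L2norm leb D' (enorm \o grad w))%E.

End thin_obstacle.

(* Main.v *)
From HB Require Import structures.
Require Import Defs.
From mathcomp Require Import all_boot all_order all_algebra.
From mathcomp Require Import all_classical all_reals all_analysis.
From mathcomp Require Import measurable_realfun.
From mathcomp Require Import ring lra.
Import Order.TTheory GRing.Theory Num.Theory.
Import numFieldNormedType.Exports.
Local Open Scope classical_set_scope.
Local Open Scope ring_scope.

(** Write [w = v - u] and [N] for the [L^2] norm of [grad w].  The set of
   admissible functions is convex, so comparing [u] with the segment from [u]
   to [v] gives the variational inequality [int grad u . grad w >= 0]
   ([minimizer_variational]); hence [N^2 <= int grad v . grad w]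
   ([grad_diff_le]).  In the right-hand side [grad v] is split into
   [(grad v - q) + q].  The first part is estimated by Cauchy-Schwarz.  In the
   second part the flux is integrated by parts against [w], which lies in
   [H^1_0]: this produces the two divergences, controlled by the Friedrichs
   inequalities, and the jump of the normal component, which is replaced by
   [lambda] at the price of [lambda - jump], controlled by the trace inequality
   ([flux_bound]).  What remains is [int_M lambda w]; since [lambda >= 0] and
   [u >= psi] on [M], it is at most [S = int_M lambda (v - psi)].  Altogether
   [N^2 <= A N + S], where [A] is the sum of the norms in the statement, and so
   [N <= A + sqrt S <= A + sqrt 2 * sqrt S] ([quadratic_bound]).

   Most of the work is in making these manipulations legitimate.  Integrals are
   additive, and norms subadditive, only for measurable functions; so the
   smooth functions that define weak gradients and traces have to be measurable
   for Lebesgue and Hausdorff measure, which both come from Caratheodory's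
   construction.  Open sets are shown to be measurable through coordinate
   half-spaces: a box is cut by a hyperplane into two boxes with the same total
   volume ([lebesgue_outer_halfspace]), and the Hausdorff outer measure is
   additive on sets at positive distance, to which Caratheodory's layer
   argument applies ([caratheodory_sublevel]).

   A trace is only known as a limit of restrictions of smooth functions, and
   the trace of [v] in the statement could differ from the one that witnesses
   the obstacle condition.  Their difference is a trace of [0], which lies in
   [H^1_0], so the trace inequality forces them to agree almost everywhere
   ([trace_unique]).  The obstacle [psi] is not assumed measurable on [M]; the
   integral [S] is compared with that of [lambda w] by a monotonicity property
   that requires measurability of the smaller function alone
   ([ae_le_integral]). *)

Set Implicit Arguments.
Unset Strict Implicit.
Unset Printing Implicit Defensive.

(** * Splitting coverings: Lebesgue and Hausdorff outer measure *)

(** Superadditivity of an outer measure defined by coverings: a covering of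
   [A `|` B] yields coverings of [A] and of [B], as soon as each of its members
   can be split without increasing the gauge. *)
Lemma mu_ext_superadditive (R : realType) d (T : semiRingOfSetsType d)
    (g : set T -> \bar R) (A B : set T) :
  (forall F, 0 <= g F)%E ->
  (forall F, measurable F -> exists F12 : set T * set T,
    [/\ measurable F12.1, measurable F12.2, A `&` F `<=` F12.1,
        B `&` F `<=` F12.2 & (g F12.1 + g F12.2 <= g F)%E]) ->
  (mu_ext g A + mu_ext g B <= mu_ext g (A `|` B))%E.
Proof.
move=> g0 split_g; apply: le_ereal_inf_tmp => _ [F [mF ABF] <-].
have [G PG] := choice (fun k => split_g _ (mF k)).
apply: (@le_trans _ _ (\sum_(k <oo) (g (G k).1 + g (G k).2))%E).
  rewrite nneseriesD//; apply: leeD.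
    apply: ereal_inf_lbound; exists (fun k => (G k).1) => //.
    split=> [k|x Ax]; first by case: (PG k).
    have [k _ Fkx] := ABF x (or_introl Ax).
    by exists k => //; case: (PG k) => _ _ + _ _; apply.
  apply: ereal_inf_lbound; exists (fun k => (G k).2) => //.
  split=> [k|x Bx]; first by case: (PG k).
  have [k _ Fkx] := ABF x (or_intror Bx).
  by exists k => //; case: (PG k) => _ _ _ + _; apply.
apply: lee_nneseries => [k _ _|k _]; first by rewrite adde_ge0.
by case: (PG k).
Qed.

Section borel.
Context (R : realType) (n : nat).
Local Notation borelRn := (g_sigma_algebraType (@open 'rV[R]_n)).

Lemma borel_open (U : set borelRn) : @open 'rV[R]_n U -> measurable U.
Proof. by move=> oU; exact: sub_sigma_algebra. Qed.

Lemma borel_closed (U : set borelRn) : @closed 'rV[R]_n U -> measurable U.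
Proof.
move=> cU; rewrite -(setCK U); apply: measurableC; apply: borel_open.
by rewrite openC.
Qed.

Lemma closed_coord_le i (c : R) : closed [set x : 'rV[R]_n | x 0 i <= c].
Proof.
have cc : continuous (fun x : 'rV[R]_n => x 0 i) by exact: coord_continuous.
exact (@preimage_closed _ _ (fun x : 'rV[R]_n => x 0 i) _ (fun x _ => cc x)
  (@closed_le R c)).
Qed.

Lemma closed_coord_ge i (c : R) : closed [set x : 'rV[R]_n | c <= x 0 i].
Proof.
have cc : continuous (fun x : 'rV[R]_n => x 0 i) by exact: coord_continuous.
exact (@preimage_closed _ _ (fun x : 'rV[R]_n => x 0 i) _ (fun x _ => cc x)
  (@closed_ge R c)).
Qed.

Lemma box_gauge_le (a b : 'rV[R]_n) : closed_box a b !=set0 ->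
  (box_gauge (closed_box a b) <= (box_volume a b)%:E)%E.
Proof.
move=> /set0P ab0; rewrite /box_gauge (negbTE ab0).
by apply: ereal_inf_lbound; exists (a, b).
Qed.

(** A hyperplane cuts a box into two boxes whose volumes add up. *)
Lemma lebesgue_outer_halfspace i (c : R) :
  (@lebesgue_outer R n).-caratheodory [set x | x 0 i <= c].
Proof.
apply: le_caratheodory_measurable => X.
set H := [set x : 'rV[R]_n | x 0 i <= c].
rewrite -[X in (_ <= lebesgue_outer n X)%E]setIT -(setUv H) setIUr.
apply: mu_ext_superadditive => [F|F mF]; first exact: box_gauge_ge0.
pose K := [set x : 'rV[R]_n | c <= x 0 i].
exists (F `&` H, F `&` K); split => /=.
- by apply: measurableI => //; apply: borel_closed; exact: closed_coord_le.
- by apply: measurableI => //; apply: borel_closed; exact: closed_coord_ge.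
- by move=> x [[_ Hx] Fx].
- move=> x [[_ Hx] Fx]; split => //; rewrite /K/=; apply: ltW.
  by rewrite ltNge; apply/negP.
have [->|F0] := eqVneq F set0; first by rewrite !set0I box_gauge0 adde0.
rewrite [leRHS]/box_gauge (negbTE F0).
apply: le_ereal_inf_tmp => _ [[a b] /= FE] <-.
have {}F0 : closed_box a b !=set0 by rewrite -FE; exact/set0P.
have [ca|ac] := ltP c (a 0 i).
  have -> : F `&` H = set0.
    rewrite -subset0 => x [+ Hx]; rewrite FE => /(_ i)/andP[ax _].
    by move: Hx; rewrite /H/= leNgt (lt_le_trans ca ax).
  have -> : F `&` K = F.
    rewrite setIidPl FE => x /(_ i)/andP[ax _].
    exact/ltW/(lt_le_trans ca ax).
  by rewrite box_gauge0 add0e FE; exact: box_gauge_le.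
have [bc|cb] := ltP (b 0 i) c.
  have -> : F `&` K = set0.
    rewrite -subset0 => x [+ Hx]; rewrite FE => /(_ i)/andP[_ bx].
    by move: Hx; rewrite /K/= leNgt (le_lt_trans bx bc).
  have -> : F `&` H = F.
    rewrite setIidPl FE => x /(_ i)/andP[_ bx].
    exact/ltW/(le_lt_trans bx bc).
  by rewrite box_gauge0 adde0 FE; exact: box_gauge_le.
pose upd (v : 'rV[R]_n) : 'rV[R]_n := \row_j (if j == i then c else v 0 j).
have ab j : a 0 j <= b 0 j.
  by have [x /(_ j)/andP[ax xb]] := F0; exact: le_trans ax xb.
have FH : F `&` H = closed_box a (upd b).
  rewrite FE; apply/seteqP; split => x.
    move=> [abx Hx] j; rewrite mxE; case: eqVneq => [->|_]; last exact: abx.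
    by apply/andP; split => //; case/andP: (abx i).
  move=> abx; split.
    move=> j; have := abx j; rewrite mxE; case: eqVneq => // -> /andP[-> xc].
    exact: le_trans xc cb.
  by have := abx i; rewrite mxE eqxx => /andP[].
have FK : F `&` K = closed_box (upd a) b.
  rewrite FE; apply/seteqP; split => x.
    move=> [abx Kx] j; rewrite mxE; case: eqVneq => [->|_]; last exact: abx.
    by apply/andP; split => //; case/andP: (abx i).
  move=> abx; split.
    move=> j; have := abx j; rewrite mxE; case: eqVneq => // -> /andP[cx ->].
    by rewrite (le_trans ac cx).
  by have := abx i; rewrite mxE eqxx => /andP[].
have -> : box_volume a b = box_volume a (upd b) + box_volume (upd a) b.
  rewrite /box_volume (bigD1 i)//= [in RHS](bigD1 i)//=.
  rewrite [X in _ = _ + X](bigD1 i)//= !mxE eqxx.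
  rewrite (eq_bigr (fun j => b 0 j - a 0 j)); last first.
    by move=> j /negbTE ji; rewrite ?mxE ?ji.
  rewrite [in RHS](eq_bigr (fun j => b 0 j - a 0 j)); last first.
    by move=> j /negbTE ji; rewrite ?mxE ?ji.
  rewrite [X in _ = _ + _ * X](eq_bigr (fun j => b 0 j - a 0 j)); last first.
    by move=> j /negbTE ji; rewrite ?mxE ?ji.
  by rewrite -mulrDl [in RHS]addrC addrA subrK.
rewrite EFinD FH FK; apply: leeD; apply: box_gauge_le.
  exists a => j; rewrite lexx/= mxE; case: eqVneq => [->|_] //.
exists b => j; rewrite lexx andbT mxE; case: eqVneq => [->|_] //.
Qed.

Lemma coord_le_enorm (x : 'rV[R]_n) i : `|x 0 i| <= enorm x.
Proof.
rewrite /enorm -sqrtr_sqr ler_wsqrtr// (bigD1 i)//= lerDl.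
by apply: sumr_ge0 => j _; exact: sqr_ge0.
Qed.

Lemma hausdorff_gauge_nonincr m (d1 d2 : R) (A : set borelRn) : d1 <= d2 ->
  (hausdorff_gauge m d2 A <= hausdorff_gauge m d1 A)%E.
Proof.
move=> d12; rewrite /hausdorff_gauge; case: eqVneq => // _.
case: ifPn => [d2A|]; first by case: ifPn => [//|_]; rewrite leey.
by case: ifPn => // d1A; rewrite (le_trans d1A)// lee_fin.
Qed.

Lemma hausdorff_delta_nonincr m (d1 d2 : R) (A : set 'rV[R]_n) : d1 <= d2 ->
  (hausdorff_delta m d2 A <= hausdorff_delta m d1 A)%E.
Proof.
move=> d12; apply: le_ereal_inf_tmp => _ [F [mF AF] <-].
apply: (@le_trans _ _ (\sum_(k <oo) (hausdorff_gauge m d2 (F k)))%E).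
  by apply: ereal_inf_lbound; exists F.
apply: lee_nneseries => [k _ _|k _]; first exact: hausdorff_gauge_ge0.
exact: hausdorff_gauge_nonincr.
Qed.

(** A set that meets both [A] and [B] has diameter larger than [d], hence
   infinite gauge; every other member of a covering serves only one of them. *)
Lemma hausdorff_delta_separated m (d : R) i (a b : R) (A B : set 'rV[R]_n) :
  d < b - a -> A `<=` [set x | x 0 i <= a] -> B `<=` [set x | b <= x 0 i] ->
  (hausdorff_delta m d A + hausdorff_delta m d B
     <= hausdorff_delta m d (A `|` B))%E.
Proof.
move=> dab Aa Bb; apply: mu_ext_superadditive => [F|F mF].
  exact: hausdorff_gauge_ge0.
have [AF|AF] := pselect (exists2 x, A x & F x); last first.
  exists (set0, F); split => //=.
  - by move=> x [Ax Fx]; apply: AF; exists x.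
  - by rewrite hausdorff_gauge0 add0e.
have [BF|BF] := pselect (exists2 x, B x & F x); last first.
  exists (F, set0); split => //=.
  - by move=> x [Bx Fx]; apply: BF; exists x.
  - by rewrite hausdorff_gauge0 adde0.
exists (F, F); split => //=.
have [x Ax Fx] := AF; have [y By Fy] := BF.
rewrite {3}/hausdorff_gauge ifF; last by apply/eqP => F0; rewrite F0 in Fx.
rewrite ifF ?leey//; apply/negbTE; rewrite -ltNge.
apply: (@lt_le_trans _ _ (enorm (y - x))%:E); last first.
  by apply: ereal_sup_ubound; exists (y, x).
rewrite lte_fin (lt_le_trans dab)// (le_trans _ (coord_le_enorm _ i))//.
rewrite !mxE (le_trans _ (ler_norm _))//.
by apply: lerB; [exact: Bb|exact: Aa].
Qed.

(** The scales realizing the two suprema on the left may differ; the estimate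
   is applied at a scale below both and below the gap [b - a]. *)
Lemma hausdorff_outer_separated m i (a b : R) (A B : set 'rV[R]_n) :
  a < b -> A `<=` [set x | x 0 i <= a] -> B `<=` [set x | b <= x 0 i] ->
  (hausdorff_outer n m A + hausdorff_outer n m B
     <= hausdorff_outer n m (A `|` B))%E.
Proof.
move=> ab Aa Bb; set Z := hausdorff_outer n m (A `|` B).
have [->|Zoo] := eqVneq Z +oo%E; first exact: leey.
have AZ : (hausdorff_outer n m A <= Z)%E by exact: le_hausdorff_outer.
have BZ : (hausdorff_outer n m B <= Z)%E by exact: le_hausdorff_outer.
have fin_le x : (0 <= x -> x <= Z -> x \is a fin_num)%E.
  move=> x0 xZ; rewrite ge0_fin_numE// (le_lt_trans xZ)// ltey//.
rewrite -leeBrDr; last by rewrite fin_le// hausdorff_outer_ge0.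
apply: ge_ereal_sup => _ [d1 /= d10 <-].
have d1fin : hausdorff_delta m d1 A \is a fin_num.
  rewrite fin_le//; first exact/mu_ext_ge0/hausdorff_gauge_ge0.
  exact: le_trans (hausdorff_delta_le _ _ d10) AZ.
rewrite leeBrDr; last by rewrite fin_le// hausdorff_outer_ge0.
rewrite -leeBrDl//; apply: ge_ereal_sup => _ [d2 /= d20 <-].
rewrite leeBrDl//.
pose d := Num.min (Num.min d1 d2) ((b - a) / 2).
have d0 : 0 < d by rewrite !lt_min d10 d20/= divr_gt0// subr_gt0.
apply: le_trans (hausdorff_delta_le m _ d0).
apply: (@le_trans _ _ (hausdorff_delta m d A + hausdorff_delta m d B)%E).
  by apply: leeD; apply: hausdorff_delta_nonincr; rewrite !ge_min lexx ?orbT.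
apply: (hausdorff_delta_separated _ _ Aa Bb).
rewrite /d gt_min; apply/orP; right.
by rewrite ltr_pdivrMr// ltr_pMr ?subr_gt0//; lra.
Qed.

End borel.

(** * Caratheodory measurability of open sets *)

Section layers.
Context (R : realType) (T : Type) (mu : {outer_measure set T -> \bar R}).
Variable f : T -> R.
Hypothesis sep : forall (a b : R) (A B : set T), a < b ->
  A `<=` [set x | f x <= a] -> B `<=` [set x | b <= f x] ->
  (mu A + mu B <= mu (A `|` B))%E.

(** Caratheodory's criterion for metric outer measures, along one function.
   The part of [X] above [c] is exhausted by the sets [A k] where
   [f >= c + 1/(k+1)], which are separated from the part below [c]; what [A N]
   misses is a union of layers [L k], and layers two steps apart are separated,
   so their measures are summable and the remainder tends to [0]. *)
Lemma caratheodory_sublevel (c : R) : mu.-caratheodory [set x | f x <= c].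
Proof.
apply: le_caratheodory_measurable => X.
set H := [set x : T | f x <= c].
have [->|Xoo] := eqVneq (mu X) +oo%E; first exact: leey.
pose e (k : nat) : R := c + k.+1%:R^-1.
have ce k : c < e k by rewrite /e ltrDl invr_gt0.
have e_decr k : e k.+1 < e k.
  by rewrite /e ltrD2l ltf_pV2 ?posrE// ltr_nat.
pose A k := X `&` [set x | e k <= f x].
pose L k := X `&` [set x | e k.+1 <= f x < e k].
have muX S : S `<=` X -> (mu S <= mu X)%E by move=> SX; exact: le_outer_measure.
have muL0 k : (0 <= mu (L k))%E by exact: outer_measure_ge0.
have AL k : (mu (A k) + mu (L k.+1) <= mu (A k.+2))%E.
  rewrite addeC; apply: (@le_trans _ _ (mu (L k.+1 `|` A k))).
    apply: (sep (e_decr k)).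
      by move=> x [_ /andP[_ /ltW]].
    by move=> x [].
  apply: le_outer_measure => x [[Xx /andP[ex _]]|[Xx ex]]; split => //=.
  by rewrite (le_trans _ ex)// ltW// (lt_trans (e_decr _)).
have L_sum N : (\sum_(0 <= k < N.+1) mu (L k) <= mu (A N) + mu (A N.+1))%E.
  elim: N => [|N IH].
    rewrite big_nat1; apply: lee_paddl; first exact: outer_measure_ge0.
    by apply: le_outer_measure => x [Xx /andP[]].
  rewrite big_nat_recr//=; apply: le_trans (leeD2r _ IH) _.
  by rewrite addeAC addeC leeD2l.
have Lfin : (\sum_(k <oo) mu (L k) < +oo)%E.
  apply: (@le_lt_trans _ _ (mu X + mu X)%E).
    apply: lime_le; first exact: is_cvg_nneseries.
    near=> N.
    have -> : N = N.-1.+1 by rewrite prednK//; near: N; exists 1%N.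
    by apply: le_trans (L_sum _) _; apply: leeD; apply: muX => x [].
  by rewrite lte_add_pinfty// ltey.
have tail := nneseries_tail_cvg Lfin (fun k _ => muL0 k).
have XH_le N : (mu (X `&` ~` H) <= mu (A N) + \sum_(N <= k <oo) mu (L k))%E.
  rewrite -nneseries_addn//.
  apply: le_trans (leeD2l _ (outer_measure_sigma_subadditive mu _)).
  apply: le_trans (outer_measureU2 _ _ _); apply: le_outer_measure.
  move=> x [Xx /negP]; rewrite -ltNge => cx.
  have [ex|ex] := leP (e N) (f x); [by left|right].
  have [k0 fk0] : exists k, e k <= f x.
    have : 0 < f x - c by rewrite subr_gt0.
    have := @near_infty_natSinv_lt R => /(_ _)/= K fxc.
    have [k _ kP] := K (PosNum fxc); exists k.
    by rewrite /e -lerBrDl; apply/ltW/(kP k)/leqnn.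
  (* The layer containing [x] is the one before the first level [e k] that
     [f x] reaches. *)
  have [k ek kmin] := ex_minnP (ex_intro (fun k => e k <= f x) k0 fk0).
  have Nk : (N < k)%N.
    rewrite ltnNge; apply/negP => kN.
    move: ex; rewrite ltNge; apply/negP; rewrite negbK (le_trans _ ek)//.
    rewrite /e lerD2l lef_pV2 ?posrE// ler_nat//.
  exists (k.-1 - N)%N => //; rewrite subnK; last first.
    by rewrite -ltnS prednK// (leq_ltn_trans _ Nk).
  have k1 : k.-1.+1 = k by rewrite prednK// (leq_ltn_trans _ Nk).
  split => //=; rewrite k1 ek/= ltNge; apply/negP => /kmin.
  by rewrite -{1}k1 ltnn.
have bound N : (mu (X `&` H) + mu (X `&` ~` H) <=
    mu X + \sum_(N <= k <oo) mu (L k))%E.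
  apply: le_trans (leeD2l _ (XH_le N)) _; rewrite addeA leeD2r//.
  apply: le_trans; first by apply: (sep (ce N)) => x [].
  by apply: muX => x [] [].
have lim : (mu X + \sum_(N <= k <oo) mu (L k) @[N --> \oo] --> mu X + 0)%E.
  apply: cvgeD => //; last exact: cvg_cst.
  by rewrite fin_num_adde_defl.
rewrite adde0 in lim; rewrite -(cvg_lim _ lim)//.
apply: lime_ge; first by apply/cvg_ex; exists (mu X).
by apply: nearW.
Unshelve. all: by end_near. Qed.

End layers.

Lemma hausdorff_outer_halfspace (R : realType) (n m : nat) i (c : R) :
  (@hausdorff_outer R n m).-caratheodory [set x | x 0 i <= c].
Proof.
apply: (@caratheodory_sublevel R _ _ (fun x : 'rV[R]_n => x 0 i)).
by move=> a b A B; exact: hausdorff_outer_separated.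
Qed.

Section open_measurable.
Context (R : realType) (n : nat) (mu : {outer_measure set 'rV[R]_n -> \bar R}).
Hypothesis halfspace : forall i c, mu.-caratheodory [set x | x 0 i <= c].
Local Notation T := (caratheodory_type mu).

Lemma coord_measurable i : measurable_fun setT (fun x : T => x 0 i : R).
Proof.
move=> mT; apply: (measurability _ (RGenOInfty.measurableE R)) => // _ [_ [c ->] <-].
rewrite setTI (_ : _ @^-1` _ = ~` [set x : T | x 0 i <= c]).
  by apply: measurableC; exact: halfspace.
by apply/seteqP; split=> x /=; rewrite in_itv/= andbT ltNge => /negP.
Qed.

(** An open set is the union of the countably many cubes with rational centre
   and radius [1/(k+1)] that it contains. *)
Lemma open_measurable_cara (U : set 'rV[R]_n) : open U ->
  measurable (U : set T).
Proof.
move=> oU.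
pose B (p : 'rV[rat]_n * nat) : set T :=
  [set x : T | forall i, ball (ratr (p.1 0 i) : R) p.2.+1%:R^-1 (x 0 i)].
have mB p : measurable (B p).
  rewrite (_ : B p = \bigcap_(i in [set: 'I_n])
      ((fun x : T => x 0 i) @^-1` ball (ratr (p.1 0 i) : R) p.2.+1%:R^-1)).
    apply: fin_bigcap_measurable => // i _; rewrite -[X in measurable X]setTI.
    by apply: coord_measurable => //; apply: open_measurable; exact: ball_open.
  by apply/seteqP; split=> x /= xB i => [_|]; exact: xB.
rewrite (_ : U = \bigcup_p (if `[<B p `<=` U>] then B p else set0)).
  apply: countable_bigcupT_measurable => [|p]; first exact: countableP.
  by case: ifP.
apply/seteqP; split => [x Ux|x [p _]]; last by case: ifPn => // /asboolP; apply.
have /nbhs_ballP[e /= e0 xeU] := open_nbhs_nbhs (conj oU Ux).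
have e20 : 0 < e / 2 by rewrite divr_gt0.
have [k _ kP] := @near_infty_natSinv_lt R (PosNum e20).
have {kP} ke : k.+1%:R^-1 < e / 2 := kP k (leqnn k).
have k0 : (0 : R) < k.+1%:R^-1 by rewrite invr_gt0.
have [q Pq] : exists q : 'I_n -> rat,
    forall i, ball (x 0 i) k.+1%:R^-1 (ratr (q i) : R).
  have K i : exists r : rat, ball (x 0 i) k.+1%:R^-1 (ratr r : R).
    have /dense_rat : ball (x 0 i) k.+1%:R^-1 !=set0.
      by exists (x 0 i); exact: ballxx.
    by case/(_ (ball_open _ _)) => z [Bz [r _ rz]]; exists r; rewrite rz.
  by have [q Pq] := choice K; exists q.
exists (\row_i q i, k) => //; rewrite ifT.
  by move=> i /=; rewrite mxE; exact: ball_sym.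
apply/asboolP => y By; apply: xeU; split=> // i j; rewrite ord1.
apply: (@le_ball _ _ _ (k.+1%:R^-1 + k.+1%:R^-1)).
  by rewrite [e]splitr lerD// ltW.
by apply: ball_triangle (Pq j) _; have := By j; rewrite /= mxE.
Qed.

Lemma continuous_measurable_cara (f : 'rV[R]_n -> R) : continuous f ->
  measurable_fun setT (f : T -> R).
Proof.
move=> /continuousP cf mT.
apply: (measurability _ (RGenOpens.measurableE R)) => // _ [_ [a [b ->] <-]].
rewrite setTI; apply: open_measurable_cara; exact/cf/interval_open.
Qed.

End open_measurable.

(** * The space L^2 of a measure *)

Section L2_theory.
Context d (T : measurableType d) (R : realType) (mu : {measure set T -> \bar R}).
Implicit Types (D : set T) (f g : T -> R).

Lemma L2normE D f :
  L2norm mu D f = ((\int[mu]_(x in D) (f x ^+ 2)%:E) `^ 2^-1)%E.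
Proof.
rewrite /L2norm unlock [in RHS]integral_mkcond; congr (_ `^ _)%E.
apply: eq_integral => x _ /=; rewrite patchE /= patchE.
case: ifP => _; last by rewrite normr0 powR0// gt_eqF.
by rewrite powR_mulrn// real_normK// num_real.
Qed.

Lemma L2norm_ge0 D f : (0 <= L2norm mu D f)%E.
Proof. exact: Lnorm_ge0. Qed.

Lemma L2P D f : measurable D ->
  L2 mu D f <-> measurable_fun D f /\ (L2norm mu D f < +oo)%E.
Proof.
move=> mD; rewrite /L2 inE; split.
  case/andP; rewrite !inE/= => mf fin; split => //.
  exact/(measurable_restrictT _ mD).2.
move=> [mf fin]; apply/andP; rewrite !inE/=; split => //.
exact/(measurable_restrictT _ mD).1.
Qed.

Lemma L2norm_fin D f : L2 mu D f -> L2norm mu D f \is a fin_num.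
Proof.
rewrite /L2 inE => /andP[_]; rewrite inE => fin.
by rewrite ge0_fin_numE// L2norm_ge0.
Qed.

Lemma eq_L2norm D f g : (forall x, D x -> f x = g x) ->
  L2norm mu D f = L2norm mu D g.
Proof.
move=> fg; rewrite !L2normE; congr (_ `^ _)%E.
by apply: eq_integral => x; rewrite inE => /fg ->.
Qed.

Lemma L2normD D f g : measurable D -> measurable_fun D f ->
  measurable_fun D g ->
  (L2norm mu D (fun x => (f x + g x)%R) <= L2norm mu D f + L2norm mu D g)%E.
Proof.
move=> mD mf mg.
have {}mf := (measurable_restrictT _ mD).1 mf.
have {}mg := (measurable_restrictT _ mD).1 mg.
rewrite /L2norm (_ : _ \_ D = (f \_ D) \+ (g \_ D)); last first.
  by apply/funext => x /=; rewrite !patchE; case: ifP => // _; rewrite addr0.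
by apply: minkowski; rewrite ?ler1n.
Qed.

Lemma L2normZ D (a : R) f : measurable D -> measurable_fun D f ->
  L2norm mu D (fun x => a * f x) = (`|a|%:E * L2norm mu D f)%E.
Proof.
move=> mD mf; rewrite !L2normE.
under eq_integral do rewrite exprMn EFinM.
rewrite ge0_integralZl//; last 3 first.
- by apply/measurable_EFinP; exact: measurable_funX.
- by move=> x _; rewrite lee_fin sqr_ge0.
- by rewrite lee_fin sqr_ge0.
rewrite poweRM ?lee_fin ?sqr_ge0//; last first.
  by apply: integral_ge0 => x _; rewrite lee_fin sqr_ge0.
congr (_ * _)%E; rewrite poweR_EFin powR12_sqrt ?sqr_ge0//.
by rewrite sqrtr_sqr.
Qed.

Lemma le_L2norm D f g : measurable D -> measurable_fun D f ->
  measurable_fun D g -> (forall x, D x -> `|f x| <= `|g x|) ->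
  (L2norm mu D f <= L2norm mu D g)%E.
Proof.
move=> mD mf mg fg; rewrite !L2normE.
rewrite gt0_ler_poweR//.
- by rewrite in_itv/= leey andbT integral_ge0// => x _; rewrite lee_fin sqr_ge0.
- by rewrite in_itv/= leey andbT integral_ge0// => x _; rewrite lee_fin sqr_ge0.
apply: ge0_le_integral => //.
- by move=> x _; rewrite lee_fin sqr_ge0.
- by apply/measurable_EFinP; exact: measurable_funX.
- by apply/measurable_EFinP; exact: measurable_funX.
move=> x Dx; rewrite lee_fin -(real_normK (num_real (f x))).
by rewrite -(real_normK (num_real (g x))) lerXn2r// ?nnegrE// fg.
Qed.

Lemma L2norm_subset D D' f : measurable D -> measurable D' -> D' `<=` D ->
  measurable_fun D f -> (L2norm mu D' f <= L2norm mu D f)%E.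
Proof.
move=> mD mD' D'D mf; rewrite !L2normE.
rewrite gt0_ler_poweR//.
- by rewrite in_itv/= leey andbT integral_ge0// => x _; rewrite lee_fin sqr_ge0.
- by rewrite in_itv/= leey andbT integral_ge0// => x _; rewrite lee_fin sqr_ge0.
apply: ge0_subset_integral => //.
- by apply/measurable_EFinP; exact: measurable_funX.
- by move=> x _; rewrite lee_fin sqr_ge0.
Qed.

Lemma L2_subset D D' f : measurable D -> measurable D' -> D' `<=` D ->
  L2 mu D f -> L2 mu D' f.
Proof.
move=> mD mD' D'D /(L2P _ mD)[mf fin]; apply/(L2P _ mD'); split.
  exact: measurable_funS mf.
exact: le_lt_trans (L2norm_subset _ _ _ _) fin.
Qed.

Lemma L2_lin D (a b : R) f g : measurable D -> L2 mu D f -> L2 mu D g ->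
  L2 mu D (fun x => a * f x + b * g x).
Proof.
move=> mD /(L2P _ mD)[mf ff] /(L2P _ mD)[mg fg]; apply/(L2P _ mD).
have maf : measurable_fun D (fun x => a * f x) by exact: measurable_funM.
have mbg : measurable_fun D (fun x => b * g x) by exact: measurable_funM.
split; first exact: measurable_funD.
apply: le_lt_trans (L2normD mD maf mbg) _.
by rewrite !L2normZ//; apply: lte_add_pinfty; apply: lte_mul_pinfty.
Qed.

Lemma L2_mul_integrable D f g : measurable D -> L2 mu D f -> L2 mu D g ->
  mu.-integrable D (EFin \o (fun x => f x * g x)).
Proof.
move=> mD f2 g2; have := Lfun2_mul_Lfun1 f2 g2.
move/Lfun1_integrable => fgi; apply/(integrable_mkcond _ mD).
apply: eq_integrable fgi => // x _ /=; rewrite !patchE.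
by case: ifP => // _; rewrite mulr0.
Qed.

Lemma L2_cauchy_schwarz D f g : measurable D -> L2 mu D f -> L2 mu D g ->
  (`|\int[mu]_(x in D) (f x * g x)|%:E <= L2norm mu D f * L2norm mu D g)%E.
Proof.
move=> mD f2 g2; have fgi := L2_mul_integrable mD f2 g2.
rewrite EFin_normr_Rintegral//.
move: (f2) (g2) => /(L2P _ mD)[mf _] /(L2P _ mD)[mg _].
apply: (le_trans (le_abse_integral mu mD _)); first by case/integrableP: fgi.
rewrite /L2norm; apply: (@le_trans _ _ ('N[mu]_1[EFin \o ((f \_ D) \* (g \_ D))%R]))%E.
  rewrite Lnorm1 integral_mkcond; rewrite le_eqVlt.
  apply/orP; left; apply/eqP/eq_integral => x _ /=; rewrite !patchE.
  by case: ifP => // _; rewrite mulr0 normr0.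
apply: hoelder => //; [| |by rewrite [RHS]splitr !div1r].
  exact/(measurable_restrictT _ mD).1.
exact/(measurable_restrictT _ mD).1.
Qed.

Lemma L2norm_sqr D f : L2 mu D f ->
  fine (L2norm mu D f) ^+ 2 = \int[mu]_(x in D) (f x ^+ 2).
Proof.
move=> f2; have := L2norm_fin f2.
rewrite L2normE /Rintegral; set I := (\int[mu]_(x in D) _)%E.
have : (0 <= I)%E by apply: integral_ge0 => x _; rewrite lee_fin sqr_ge0.
case: I => [r| |] //; last by rewrite poweRyr.
rewrite lee_fin => r0 _.
by rewrite poweR_EFin/= powR12_sqrt// sqr_sqrtr.
Qed.

(** The integral of a nonnegative function is a supremum over the simple
   functions below it, so monotonicity holds without measurability. *)
Lemma ge0_le_integral_lower (f g : T -> \bar R) :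
  (forall x, 0 <= f x)%E -> (forall x, f x <= g x)%E ->
  (\int[mu]_x f x <= \int[mu]_x g x)%E.
Proof.
move=> f0 fg; have g0 x : (0 <= g x)%E by exact: le_trans (f0 x) (fg x).
rewrite !ge0_integralTE//; apply: ereal_sup_le => _ [h hf <-].
by exists h => // x; exact: le_trans (hf x) (fg x).
Qed.

(** Meant for [g = lambda (v - psi)], where [psi] may fail to be measurable.
   Off a null set [f] lies below the positive part of [g], and there the negative
   part of [g] vanishes. *)
Lemma ae_le_integral D f g : measurable D ->
  mu.-integrable D (EFin \o f) ->
  {ae mu, forall x, D x -> f x <= g x} ->
  {ae mu, forall x, D x -> 0 <= g x} ->
  (\int[mu]_(x in D) (f x)%:E <= \int[mu]_(x in D) (g x)%:E)%E.
Proof.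
move=> mD fi [N1 [mN1 N10 fgN1]] [N2 [mN2 N20 g0N2]].
pose N := N1 `|` N2.
have mN : measurable N by exact: measurableU.
have N0 : mu N = 0 by rewrite measureU0.
have fg x : D x -> ~ N x -> 0 <= g x /\ f x <= g x.
  move=> Dx Nx; split; apply: contrapT => ng; apply: Nx.
    by right; apply: g0N2 => /(_ Dx).
  by left; apply: fgN1 => /(_ Dx).
rewrite (negligible_integral mN mD fi N0).
rewrite [leRHS]integralE [X in (_ - X)%E](_ : _ = 0) ?sube0; last first.
  apply/eqP; rewrite eq_le; apply/andP; split; last exact: integral_ge0.
  apply: (@le_trans _ _ (\int[mu]_(x in N) +oo)%E).
    rewrite integral_mkcond [leRHS]integral_mkcond.
    apply: ge0_le_integral_lower => x; first exact: erestrict_ge0.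
    rewrite !patchE; case: ifPn => Dx; case: ifPn => Nx; rewrite ?leey//.
    rewrite inE in Dx; rewrite notin_setE in Nx.
    rewrite funenegE ge_max lexx andbT.
    by have [g0 _] := fg _ Dx Nx; rewrite -EFinN lee_fin oppr_le0.
  by rewrite null_set_integral.
have mDN : measurable (D `\` N) by exact: measurableD.
apply: (@le_trans _ _ (\int[mu]_(x in D `\` N) ((EFin \o f)^\+ x))%E).
  apply: le_integral => //.
  - by apply: integrableS fi.
  - by apply: integrable_funepos => //; apply: integrableS fi.
  - by move=> x _; rewrite funeposE le_max lexx.
rewrite integral_mkcond [leRHS]integral_mkcond.
apply: ge0_le_integral_lower => x; first exact: erestrict_ge0.
rewrite !patchE; case: ifPn => DNx; case: ifPn => Dx //.
- rewrite inE in DNx; have [_ fgx] := fg _ DNx.1 DNx.2.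
  by rewrite !funeposE/= ge_max !le_max lee_fin fgx lexx orbT.
- by move: DNx Dx; rewrite inE notin_setE => -[].
- by rewrite funeposE le_max lexx orbT.
Qed.

End L2_theory.

Lemma ae_imp2 d (T : measurableType d) (R : realType)
    (mu : {measure set T -> \bar R}) (P Q S : T -> Prop) :
  {ae mu, forall x, P x} -> {ae mu, forall x, Q x} ->
  (forall x, P x -> Q x -> S x) -> {ae mu, forall x, S x}.
Proof. by move=> aP aQ PQS; apply: filterS2 aP aQ. Qed.

Lemma L2norm_eq0 d (T : measurableType d) (R : realType)
    (mu : {measure set T -> \bar R}) (D : set T) (f : T -> R) :
  measurable D -> measurable_fun D f -> L2norm mu D f = 0%E ->
  {ae mu, forall x, D x -> f x = 0}.
Proof.
move=> mD mf N0.
have mfD : measurable_fun setT (EFin \o (f \_ D)).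
  by apply/measurable_EFinP; exact: (measurable_restrictT _ mD).1 mf.
have f0 := Lnorm_eq0_eq0 mfD (lte0n 2) N0.
apply: (ae_imp2 f0 f0) => x + _ Dx => /(_ I)/=.
by rewrite patchE mem_set// => -[].
Qed.


(** * Euclidean vectors, smooth functions, measurability *)

Section euclidean.
Context (R : realType) (n : nat).
Implicit Types x y z : 'rV[R]_n.

Lemma sqr_enorm x : enorm x ^+ 2 = \sum_(i < n) x 0 i ^+ 2.
Proof. by rewrite sqr_sqrtr// sumr_ge0// => i _; exact: sqr_ge0. Qed.

Lemma enorm_ge0 x : 0 <= enorm x. Proof. exact: sqrtr_ge0. Qed.

Lemma dotvv x : dotv x x = enorm x ^+ 2.
Proof. by rewrite sqr_enorm; apply: eq_bigr => i _; rewrite expr2. Qed.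

Lemma dotvC x y : dotv x y = dotv y x.
Proof. by apply: eq_bigr => i _; rewrite mulrC. Qed.

Lemma dotv_lin a b x y z :
  dotv (a *: x + b *: y) z = a * dotv x z + b * dotv y z.
Proof.
rewrite /dotv !mulr_sumr -big_split/=; apply: eq_bigr => i _.
by rewrite !mxE mulrDl !mulrA.
Qed.

Lemma sqr_enorm_lin a b x y : enorm (a *: x + b *: y) ^+ 2 =
  a ^+ 2 * enorm x ^+ 2 + 2 * a * b * dotv x y + b ^+ 2 * enorm y ^+ 2.
Proof.
rewrite -!dotvv dotv_lin ![dotv _ (_ + _)]dotvC !dotv_lin (dotvC y x).
ring.
Qed.

Lemma enorm0P x : enorm x = 0 -> forall i, x 0 i = 0.
Proof.
move=> x0 i; apply/eqP; rewrite -normr_eq0 eq_le normr_ge0 andbT -x0.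
exact: coord_le_enorm.
Qed.

(** With [Y = |y|^2] and [P = x . y], the inequality [P^2 <= |x|^2 Y] is
   [0 <= |Y x - P y|^2] divided by [Y]. *)
Lemma dotv_le x y : `|dotv x y| <= enorm x * enorm y.
Proof.
have [y0|y0] := eqVneq (enorm y) 0.
  rewrite y0 mulr0 (_ : dotv x y = 0) ?normr0//.
  by apply: big1 => i _; rewrite (enorm0P y0) mulr0.
have {}y0 : 0 < enorm y by rewrite lt_neqAle eq_sym y0 enorm_ge0.
rewrite -(ler_pXn2r (n := 2)) ?nnegrE ?mulr_ge0 ?enorm_ge0 ?normr_ge0//.
rewrite real_normK ?num_real// exprMn.
have := sqr_ge0 (enorm ((enorm y ^+ 2) *: x + (- dotv x y) *: y)).
rewrite sqr_enorm_lin => H.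
rewrite -subr_ge0 -(pmulr_rge0 _ (exprn_gt0 2 y0)).
by apply: le_trans H _; rewrite le_eqVlt; apply/orP; left; apply/eqP; ring.
Qed.

Lemma enormD x y : enorm (x + y) <= enorm x + enorm y.
Proof.
rewrite -(ler_pXn2r (n := 2)) ?nnegrE ?addr_ge0 ?enorm_ge0//.
rewrite -[x]scale1r -[y]scale1r sqr_enorm_lin !scale1r.
have := le_trans (ler_norm _) (dotv_le x y).
by rewrite sqrrD; nra.
Qed.

Lemma enormZ a x : enorm (a *: x) = `|a| * enorm x.
Proof.
rewrite /enorm; under eq_bigr do rewrite mxE exprMn.
by rewrite -mulr_sumr sqrtrM ?sqr_ge0// sqrtr_sqr.
Qed.

Lemma enorm_lin a b x y :
  enorm (a *: x + b *: y) <= `|a| * enorm x + `|b| * enorm y.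
Proof. by rewrite -!enormZ enormD. Qed.

End euclidean.

Section smooth_functions.
Context (R : realType) (n : nat).
Implicit Types f g : 'rV[R]_n -> R.

Lemma smooth_continuous f : smooth f -> continuous f.
Proof. by move=> /(_ 0%N)[]. Qed.

Lemma smooth_partial_continuous f i : smooth f -> continuous (partial i f).
Proof. by move=> /(_ 1%N)[_ /(_ i)[_ []]]. Qed.

Lemma smooth_derivable f i x : smooth f -> derivable f x (delta_mx 0 i : 'rV[R]_n).
Proof. by move=> /(_ 1%N)[_ /(_ i)[/(_ x)]]. Qed.

Lemma derivable_lin f g a b x v : derivable f x v -> derivable g x v ->
  derivable (fun y => a * f y + b * g y) x v.
Proof.
move=> df dg.
exact (derivableD (derivableZ (k := a) df) (derivableZ (k := b) dg)).
Qed.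

Lemma partial_lin f g a b i :
  (forall x, derivable f x (delta_mx 0 i : 'rV[R]_n)) ->
  (forall x, derivable g x (delta_mx 0 i : 'rV[R]_n)) ->
  partial i (fun y => a * f y + b * g y) =
  (fun y => a * partial i f y + b * partial i g y).
Proof.
move=> df dg; apply/funext => x; rewrite /partial.
have := deriveD (derivableZ (k := a) (df x)) (derivableZ (k := b) (dg x)).
by rewrite !deriveZ.
Qed.

Lemma continuous_lin f g a b : continuous f -> continuous g ->
  continuous (fun y => a * f y + b * g y).
Proof.
move=> cf cg x.
have af := cvgM (cvg_cst a) (cf x); have bg := cvgM (cvg_cst b) (cg x).
exact: (cvgD (af _ _) (bg _ _)).
Qed.

Lemma Ck_lin k f g a b : Ck k f -> Ck k g -> Ck k (fun y => a * f y + b * g y).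
Proof.
elim: k f g => [|k IH] f g [cf df] [cg dg].
  by split=> //; exact: continuous_lin.
split; first exact: continuous_lin.
move=> i; have [dfi Cf] := df i; have [dgi Cg] := dg i; split=> [x|].
  exact: derivable_lin.
by rewrite partial_lin//; exact: IH.
Qed.

Lemma smooth_lin f g a b : smooth f -> smooth g ->
  smooth (fun y => a * f y + b * g y).
Proof. by move=> sf sg k; exact: Ck_lin. Qed.

Lemma gradient_lin f g a b x : smooth f -> smooth g ->
  gradient (fun y => a * f y + b * g y) x =
  a *: gradient f x + b *: gradient g x.
Proof.
move=> sf sg; apply/rowP => i; rewrite !mxE partial_lin//.
  by move=> y; exact: smooth_derivable.
by move=> y; exact: smooth_derivable.
Qed.

End smooth_functions.

Section measurability.
Context (R : realType) (n : nat).
Implicit Types (U : set 'rV[R]_n).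
Local Notation lebT := (caratheodory_type (lebesgue_outer (R:=R) n)).
Local Notation surfT := (caratheodory_type (hausdorff_outer (R:=R) n n.-1)).

Lemma open_leb U : open U -> measurable (U : set lebT).
Proof. by apply: open_measurable_cara => i c; exact: lebesgue_outer_halfspace. Qed.

Lemma open_surf U : open U -> measurable (U : set surfT).
Proof. by apply: open_measurable_cara => i c; exact: hausdorff_outer_halfspace. Qed.

Lemma continuous_leb (f : 'rV[R]_n -> R) (D : set lebT) : continuous f ->
  measurable_fun D (f : lebT -> R).
Proof.
move=> cf; apply: measurable_funTS; apply: continuous_measurable_cara => //.
by move=> i c; exact: lebesgue_outer_halfspace.
Qed.

Lemma continuous_surf (f : 'rV[R]_n -> R) (D : set surfT) : continuous f ->
  measurable_fun D (f : surfT -> R).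
Proof.
move=> cf; apply: measurable_funTS; apply: continuous_measurable_cara => //.
by move=> i c; exact: hausdorff_outer_halfspace.
Qed.

Lemma surf_boundary U : measurable (boundary U : set surfT).
Proof.
apply: (@measurableD _ surfT); last exact/open_surf/open_interior.
rewrite -(setCK (closure U)); apply: (@measurableC _ surfT); apply: open_surf.
by rewrite openC; exact: closed_closure.
Qed.

Lemma measurable_enorm d (T : measurableType d) (D : set T) (q : T -> 'rV[R]_n) :
  (forall i, measurable_fun D (fun x => q x 0 i)) ->
  measurable_fun D (fun x => enorm (q x)).
Proof.
move=> mq.
have ms : measurable_fun [set: R] (@Num.sqrt R).
  by apply: continuous_measurable_fun; exact: sqrt_continuous.
have mQ : measurable_fun D (fun x => \sum_(i < n) q x 0 i ^+ 2).
  by apply: measurable_sum => i; exact: measurable_funX.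
exact: (measurableT_comp ms mQ).
Qed.

End measurability.

(** * Linear structure of H^1 and of traces *)

Section L2_vector_fields.
Context (R : realType) (n : nat).
Local Notation lebT := (caratheodory_type (lebesgue_outer (R:=R) n)).
Implicit Types (D : set lebT) (p q : lebT -> 'rV[R]_n).

Lemma L2vec_measurable D q i : measurable D -> L2vec D q ->
  measurable_fun D (fun x => q x 0 i : R).
Proof. by move=> mD /(_ i)/(L2P _ _ mD)[]. Qed.

Lemma L2vec_enorm D q : measurable D -> L2vec D q ->
  L2 (@leb R n) D (fun x => enorm (q x)).
Proof.
move=> mD q2; apply/(L2P _ _ mD); split.
  by apply: measurable_enorm => i; exact: L2vec_measurable.
rewrite L2normE; apply: poweR_lty.
under eq_integral do rewrite sqr_enorm -sumEFin.
apply: integrable_lty => //; apply: integrable_sum => // i _.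
by apply: eq_integrable (L2_mul_integrable mD (q2 i) (q2 i)).
Qed.

Lemma L2vec_lin D p q a b : measurable D -> L2vec D p -> L2vec D q ->
  L2vec D (fun x => a *: p x + b *: q x).
Proof.
move=> mD p2 q2 i; have := L2_lin a b mD (p2 i) (q2 i).
rewrite (_ : (fun x => (_ : 'rV[R]_n) 0 i) =
  (fun x => a * p x 0 i + b * q x 0 i))//.
by apply/funext => x; rewrite !mxE.
Qed.

Lemma dotv_integrable D p q : measurable D -> L2vec D p -> L2vec D q ->
  (@leb R n).-integrable D (EFin \o (fun x => dotv (p x) (q x))).
Proof.
move=> mD p2 q2.
rewrite (_ : _ \o _ = fun x => \sum_(i < n) (p x 0 i * q x 0 i)%:E)%E; last first.
  by apply/funext => x /=; rewrite sumEFin.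
by apply: integrable_sum => // i _; exact: L2_mul_integrable.
Qed.

Lemma dotv_cauchy_schwarz D p q : measurable D -> L2vec D p -> L2vec D q ->
  (`|\int[leb]_(x in D) dotv (p x) (q x)|%:E <=
   L2norm leb D (fun x => enorm (p x)) * L2norm leb D (fun x => enorm (q x)))%E.
Proof.
move=> mD p2 q2; have pqi := dotv_integrable mD p2 q2.
have ep := L2vec_enorm mD p2; have eq := L2vec_enorm mD q2.
have epq := L2_mul_integrable mD ep eq.
apply: le_trans (L2_cauchy_schwarz mD ep eq); rewrite lee_fin.
apply: le_trans (le_normr_Rintegral mD pqi) _.
apply: le_trans (ler_norm _); apply: le_Rintegral => //.
  by move/integrable_abse: pqi.
by move=> x _; exact: dotv_le.
Qed.

End L2_vector_fields.

Section bounded_support.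
Context (R : realType) (n : nat).
Local Notation lebT := (caratheodory_type (lebesgue_outer (R:=R) n)).
Local Notation borelRn := (g_sigma_algebraType (@open 'rV[R]_n)).

(** The covering of [A] by itself and empty sets. *)
Lemma mu_ext_le d (T : semiRingOfSetsType d) (g : set T -> \bar R) (A : set T) :
  g set0 = 0%E -> (forall F, 0 <= g F)%E -> measurable A ->
  (mu_ext g A <= g A)%E.
Proof.
move=> gs0 g0 mA; apply: ereal_inf_lbound.
exists (fun k => if k is 0%N then A else set0).
  by split=> [[|k]//|x Ax]; exists 0%N.
rewrite (nneseriesD1 (n := 0%N))//= eseries0 ?adde0// => k _ /=.
by case: k.
Qed.

Lemma lebesgue_outer_box (a b : 'rV[R]_n) : closed_box a b !=set0 ->
  (lebesgue_outer n (closed_box a b) <= (box_volume a b)%:E)%E.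
Proof.
move=> ab0; apply: le_trans (box_gauge_le ab0).
apply: mu_ext_le; [exact: box_gauge0|exact: box_gauge_ge0|].
rewrite (_ : closed_box a b = \bigcap_(i in [set: 'I_n])
    ([set x | a 0 i <= x 0 i] `&` [set x | x 0 i <= b 0 i])); last first.
  apply/seteqP; split=> x xab i; first by move=> _; apply/andP; exact: xab.
  by apply/andP; exact: xab.
apply: (@fin_bigcap_measurable _ borelRn) => // i _.
apply: measurableI; apply: borel_closed; first exact: closed_coord_ge.
exact: closed_coord_le.
Qed.

Lemma bounded_leb_lty (K : set 'rV[R]_n) : bounded_set K ->
  (leb (K : set lebT) < +oo)%E.
Proof.
move=> /pinfty_ex_gt0[M M0 KM].
apply: (@le_lt_trans _ _ (lebesgue_outer n (closed_box (const_mx (- M)) (const_mx M)))).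
  apply: le_outer_measure => x /KM xM i; rewrite !mxE -ler_norml.
  apply: le_trans xM; rewrite [leRHS]/Num.Def.normr/= mx_normrE.
  by have := @le_bigmax _ _ _ 0 (fun ij : 'I_1 * 'I_n => `|x ij.1 ij.2|) (0, i).
apply: (@le_lt_trans _ _ (box_volume (const_mx (- M) : 'rV[R]_n) (const_mx M))%:E).
  apply: lebesgue_outer_box; exists 0 => i; rewrite !mxE.
  by rewrite oppr_le0 (ltW M0).
exact: ltry.
Qed.

(** This makes the products in the definition of weak derivatives
   integrable. *)
Lemma L2_compact_support (D K : set 'rV[R]_n) (f : 'rV[R]_n -> R) : open D ->
  compact K -> continuous f -> (forall x, ~ K x -> f x = 0) -> L2 (@leb R n) D f.
Proof.
move=> oD cK cf f0; have mD : measurable (D : set lebT) by exact: open_leb.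
have Kclosed : closed K by apply: compact_closed => //; exact: norm_hausdorff.
have mK : measurable (K : set lebT).
  rewrite -(setCK K); apply: (@measurableC _ lebT).
  by apply: open_leb; rewrite openC.
apply/(L2P _ _ mD); split; first exact: continuous_leb.
have /pinfty_ex_gt0[M M0 fM] : bounded_set (f @` K).
  apply: compact_bounded; apply: continuous_compact => //.
  exact: continuous_subspaceT.
have {}fM x : `|f x| <= M.
  have [Kx|Kx] := pselect (K x); first by apply: fM; exists x.
  by rewrite f0// normr0 ltW.
rewrite L2normE; apply: poweR_lty.
apply: (@le_lt_trans _ _ (\int[leb]_(x in (K : set lebT)) (M ^+ 2)%:E)%E).
  rewrite integral_mkcond [leRHS]integral_mkcond.
  apply: ge0_le_integral_lower => x.
    by apply: erestrict_ge0 => y _; rewrite lee_fin sqr_ge0.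
  rewrite !patchE; case: ifPn => Dx; case: ifPn => Kx //.
  - rewrite lee_fin -real_normK ?num_real//.
    by rewrite lerXn2r ?nnegrE// ltW.
  - by rewrite notin_setE in Kx; rewrite f0// expr0n.
  - by rewrite lee_fin sqr_ge0.
rewrite integral_cst// lte_mul_pinfty ?lee_fin ?sqr_ge0//.
exact/bounded_leb_lty/compact_bounded.
Qed.

Lemma test_function_L2 (D : set 'rV[R]_n) t : open D -> test_function D t ->
  L2 (@leb R n) D t.
Proof.
move=> oD [st ct _]; apply: (L2_compact_support oD ct).
  exact: smooth_continuous.
move=> x nx; apply/eqP; apply: contrapT => /negP tx; apply: nx.
exact: subset_closure.
Qed.

Lemma test_function_partial_L2 (D : set 'rV[R]_n) t i : open D ->
  test_function D t -> L2 (@leb R n) D (partial i t).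
Proof.
move=> oD [st ct _]; apply: (L2_compact_support oD ct).
  exact: smooth_partial_continuous.
move=> x nx; rewrite /partial -(derive_cst (0 : R) x (delta_mx 0 i : 'rV[R]_n)).
apply: near_eq_derive.
have oC : open (~` closure [set y | t y != 0]).
  by rewrite openC; exact: closed_closure.
have := open_nbhs_nbhs (conj oC nx); apply: filterS => y ny.
apply/eqP; apply: contrapT => /negP ty; apply: ny; exact: subset_closure.
Qed.

End bounded_support.

Section H1_linear.
Context (R : realType) (n : nat) (D : set 'rV[R]_n) (oD : open D).
Local Notation lebT := (caratheodory_type (lebesgue_outer (R:=R) n)).
Local Notation surfT := (caratheodory_type (hausdorff_outer (R:=R) n n.-1)).

Let mD : measurable (D : set lebT).
Proof. exact: open_leb. Qed.

(** Test functions and their derivatives are in [L^2], so that both integrals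
   can be split. *)
Lemma weak_gradient_lin a b (w1 w2 : H1 D) :
  is_weak_gradient D (fun x => a * w1 x + b * w2 x)
    (fun x => a *: grad w1 x + b *: grad w2 x).
Proof.
move=> t tt i.
have t2 := test_function_L2 oD tt; have dt2 := test_function_partial_L2 i oD tt.
have e1 := gradP w1 tt i; have e2 := gradP w2 tt i.
have lin (f g h : lebT -> R) : L2 leb D f -> L2 leb D g -> L2 leb D h ->
    \int[leb]_(x in D) ((a * f x + b * g x) * h x) =
    a * \int[leb]_(x in D) (f x * h x) + b * \int[leb]_(x in D) (g x * h x).
  move=> f2 g2 h2.
  have fhi := L2_mul_integrable mD f2 h2; have ghi := L2_mul_integrable mD g2 h2.
  rewrite -!RintegralZl// -RintegralD//.
  - by apply: eq_Rintegral => x _; rewrite mulrDl !mulrA.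
  - by apply: eq_integrable (integrableZl _ a fhi).
  - by apply: eq_integrable (integrableZl _ b ghi).
have l1 := lin _ _ _ (H1fun_L2 w1) (H1fun_L2 w2) dt2.
have l2 := lin _ _ _ (grad_L2 w1 i) (grad_L2 w2 i) t2.
apply: (etrans l1); rewrite e1 e2 !mulrN -opprD; congr (- _).
apply: (etrans (esym l2)).
by apply: eq_Rintegral => x _; rewrite !mxE.
Qed.

Definition H1_lin a b (w1 w2 : H1 D) : H1 D :=
  MkH1 (L2_lin a b mD (H1fun_L2 w1) (H1fun_L2 w2))
       (L2vec_lin a b mD (grad_L2 w1) (grad_L2 w2))
       (weak_gradient_lin a b w1 w2).

Lemma L2norm_lin_cvg0 d (T : measurableType d) (mu : {measure set T -> \bar R})
    (G : set T) (a b : R) (f1 f2 f : nat -> T -> R) :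
  measurable G ->
  (forall k, measurable_fun G (f1 k)) -> (forall k, measurable_fun G (f2 k)) ->
  (forall k, measurable_fun G (f k)) ->
  (forall k x, `|f k x| <= `|a| * `|f1 k x| + `|b| * `|f2 k x|) ->
  L2norm mu G (f1 k) @[k --> \oo] --> 0%E ->
  L2norm mu G (f2 k) @[k --> \oo] --> 0%E ->
  L2norm mu G (f k) @[k --> \oo] --> 0%E.
Proof.
move=> mG m1 m2 mf ff c1 c2.
apply: (squeeze_cvge (f := fun=> 0%E)
  (h := fun k => (`|a|%:E * L2norm mu G (f1 k) + `|b|%:E * L2norm mu G (f2 k))%E)).
- apply: nearW => k; rewrite L2norm_ge0/=.
  have mn (g : T -> R) : measurable_fun G g -> measurable_fun G (fun x => `|g x|).
    exact: measurableT_comp.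
  have nn (g : T -> R) : L2norm mu G (fun x => `|g x|) = L2norm mu G g.
    rewrite !L2normE; congr (_ `^ _)%E; apply: eq_integral => x _.
    by rewrite real_normK ?num_real.
  have mZ (c : R) (g : T -> R) : measurable_fun G g ->
      measurable_fun G (fun x => c * `|g x|).
    by move=> mg; apply: measurable_funM => //; exact: mn.
  rewrite -(nn (f1 k)) -(nn (f2 k)).
  rewrite -[X in (X%:E * _)%E]normr_id -[X in (_ + X%:E * _)%E]normr_id.
  rewrite -!L2normZ//; [|exact: mn|exact: mn].
  apply: le_trans (L2normD _ mG (mZ _ _ (m1 k)) (mZ _ _ (m2 k))).
  apply: le_L2norm => //; first by apply: measurable_funD; exact: mZ.
  by move=> x _; rewrite [leRHS]ger0_norm// addr_ge0// mulr_ge0.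
- exact: cvg_cst.
- have := cvgeD _ (cvgeZl (y := `|a|%:E) _ c1) (cvgeZl (y := `|b|%:E) _ c2).
  by rewrite !mule0 adde0; apply.
Qed.

Lemma trace_lin (G : set 'rV[R]_n) a b (w1 w2 : H1 D) g1 g2 :
  measurable (G : set surfT) -> is_trace G w1 g1 -> is_trace G w2 g2 ->
  is_trace G (H1_lin a b w1 w2) (fun x => a * g1 x + b * g2 x).
Proof.
move=> mG [g12 [t1 [s1 c1 cg1 cs1]]] [g22 [t2 [s2 c2 cg2 cs2]]].
split; first exact: (@L2_lin _ surfT _ surf).
have dist (u1 u2 v1 v2 : R) : `|(a * u1 + b * u2) - (a * v1 + b * v2)| <=
    `|a| * `|u1 - v1| + `|b| * `|u2 - v2|.
  rewrite -!normrM (le_trans _ (ler_normD _ _))//.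
  by rewrite le_eqVlt; apply/orP; left; apply/eqP; congr `|_|; ring.
have mw (w : H1 D) : measurable_fun (D : set lebT) (w : lebT -> R).
  by have /(L2P _ _ mD)[] := H1fun_L2 w.
have mgw (w : H1 D) i : measurable_fun (D : set lebT) (fun x : lebT => grad w x 0 i : R).
  by have /(L2P _ _ mD)[] := grad_L2 w i.
have mG1 : measurable_fun (G : set surfT) (g1 : surfT -> R).
  by have /(L2P _ _ mG)[] := g12.
have mG2 : measurable_fun (G : set surfT) (g2 : surfT -> R).
  by have /(L2P _ _ mG)[] := g22.
have mG12 : measurable_fun (G : set surfT) (fun x : surfT => a * g1 x + b * g2 x).
  have ma1 := measurable_funM (measurable_cst a) mG1.
  have mb2 := measurable_funM (measurable_cst b) mG2.
  exact (measurable_funD ma1 mb2).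
have mtw (t : nat -> 'rV[R]_n -> R) (w : H1 D) k : (forall k, smooth (t k)) ->
    measurable_fun (D : set lebT) (fun x : lebT => t k x - w x).
  move=> st; apply: measurable_funB => //.
  by apply: continuous_leb; exact: smooth_continuous.
have mtg (t : nat -> 'rV[R]_n -> R) (g : surfT -> R) k : (forall k, smooth (t k)) ->
    measurable_fun (G : set surfT) g ->
    measurable_fun (G : set surfT) (fun x : surfT => t k x - g x).
  move=> st mg; apply: measurable_funB => //.
  by apply: continuous_surf; exact: smooth_continuous.
have mtgrad (t : nat -> 'rV[R]_n -> R) (w : H1 D) k : (forall k, smooth (t k)) ->
    measurable_fun (D : set lebT) (fun x : lebT => enorm (gradient (t k) x - grad w x)).
  move=> st; apply: measurable_enorm => i; under eq_fun do rewrite !mxE.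
  apply: measurable_funB => //.
  by apply: continuous_leb; exact: smooth_partial_continuous.
have st k : smooth (fun x => a * t1 k x + b * t2 k x) by exact: smooth_lin.
exists (fun k x => a * t1 k x + b * t2 k x); split => //.
- apply: (L2norm_lin_cvg0 (a := a) (b := b) mD _ _ _ _ c1 c2) => [k|k|k|k x].
  + exact: mtw.
  + exact: mtw.
  + exact: (mtw (fun k x => a * t1 k x + b * t2 k x) (H1_lin a b w1 w2)).
  + exact: dist.
- apply: (L2norm_lin_cvg0 (a := a) (b := b) mD _ _ _ _ cg1 cg2) => [k|k|k|k x].
  + exact: mtgrad.
  + exact: mtgrad.
  + exact: (mtgrad (fun k x => a * t1 k x + b * t2 k x) (H1_lin a b w1 w2)).
  + rewrite !(ger0_norm (enorm_ge0 _))/= (gradient_lin _ _ _ (s1 k) (s2 k)).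
    apply: le_trans (enorm_lin _ _ _ _).
    by rewrite !scalerBr opprD addrACA.
- apply: (L2norm_lin_cvg0 (a := a) (b := b) mG _ _ _ _ cs1 cs2) => [k|k|k|k x].
  + exact: mtg.
  + exact: mtg.
  + exact (mtg (fun k x => a * t1 k x + b * t2 k x) _ k st mG12).
  + exact: dist.
Qed.

End H1_linear.

(** * The variational inequality and the uniqueness of traces *)

Section variational.
Context (R : realType) (n : nat) (D M : set 'rV[R]_n) (psi phi : 'rV[R]_n -> R).
Hypothesis oD : open D.
Local Notation lebT := (caratheodory_type (lebesgue_outer (R:=R) n)).
Local Notation surfT := (caratheodory_type (hausdorff_outer (R:=R) n n.-1)).
Hypothesis mG : measurable (M `&` D : set surfT).
Local Notation K := (admissible (D := D) M psi phi).

Let mD : measurable (D : set lebT).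
Proof. exact: open_leb. Qed.

(** The obstacle and the boundary condition are both stable under convex
   combinations because taking traces is linear. *)
Lemma admissible_convex (s : R) (u v : H1 D) : 0 <= s <= 1 -> K u -> K v ->
  K (H1_lin oD (1 - s) s u v).
Proof.
move=> /andP[s0 s1] [[gu tu pu] bu] [[gv tv pv] bv]; split.
  exists (fun x => (1 - s) * gu x + s * gv x); first exact: trace_lin.
  apply: (ae_imp2 pu pv) => x {}pu {}pv Gx.
  rewrite [psi x](_ : _ = (1 - s) * psi x + s * psi x); last by ring.
  by apply: lerD; apply: ler_wpM2l; rewrite ?subr_ge0 ?pu ?pv.
have := trace_lin oD (1 - s) s (surf_boundary D) bu bv.
by rewrite (_ : (fun x => _ : R) = phi)//; apply/funext => x; ring.
Qed.

Lemma admissible_sub_H10 (u v : H1 D) : K u -> K v -> H10 (H1_lin oD 1 (-1) u v).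
Proof.
move=> [_ bu] [_ bv]; rewrite /H10/=.
have := trace_lin oD 1 (-1) (surf_boundary D) bu bv.
by rewrite (_ : (fun x => _ : R) = cst 0)//; apply/funext => x /=; ring.
Qed.

Lemma energy_lin (a b : R) (p q : lebT -> 'rV[R]_n) : L2vec D p -> L2vec D q ->
  \int[leb]_(x in D) (enorm (a *: p x + b *: q x) ^+ 2) =
  a ^+ 2 * \int[leb]_(x in D) (enorm (p x) ^+ 2) +
  2 * a * b * \int[leb]_(x in D) dotv (p x) (q x) +
  b ^+ 2 * \int[leb]_(x in D) (enorm (q x) ^+ 2).
Proof.
move=> p2 q2.
have pqi := dotv_integrable mD p2 q2.
have sqi (r : lebT -> 'rV[R]_n) : L2vec D r ->
    (@leb R n).-integrable D (EFin \o (fun x => enorm (r x) ^+ 2)).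
  move=> r2; have := dotv_integrable mD r2 r2.
  by apply: eq_integrable => // x _ /=; rewrite dotvv.
have Zi (c : R) (f : lebT -> R) : (@leb R n).-integrable D (EFin \o f) ->
    (@leb R n).-integrable D (EFin \o (fun x => c * f x)).
  by move=> fi; apply: eq_integrable (integrableZl _ c fi).
rewrite -!RintegralZl//; [|exact: sqi|exact: sqi].
have i1 := Zi (a ^+ 2) _ (sqi _ p2); have i2 := Zi (2 * a * b) _ pqi.
have i3 := Zi (b ^+ 2) _ (sqi _ q2).
have i12 : (@leb R n).-integrable D (EFin \o
    (fun x => a ^+ 2 * enorm (p x) ^+ 2 + 2 * a * b * dotv (p x) (q x))).
  by apply: eq_integrable (integrableD mD i1 i2).
rewrite -(RintegralD mD i1 i2) -(RintegralD mD i12 i3).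
by apply: eq_Rintegral => x _; rewrite sqr_enorm_lin.
Qed.

(** Finiteness of the energy lets minimality be used as an inequality between
   real numbers. *)
Lemma energy_fin (w : H1 D) : dirichlet_energy w =
  (2^-1 * \int[leb]_(x in D) (enorm (grad w x) ^+ 2))%:E.
Proof.
rewrite /dirichlet_energy EFinM /Rintegral fineK//.
have := dotv_integrable mD (grad_L2 w) (grad_L2 w).
move/(integrable_fin_num mD); congr (_ \is a fin_num).
by apply: eq_integral => x _ /=; rewrite dotvv.
Qed.

(** This is [int grad u . grad (v - u) >= 0].  The energy along the segment
   from [u] to [v] is a quadratic polynomial in [s], minimal at [s = 0]; were
   its slope negative, a small [s] would give a smaller energy. *)
Lemma minimizer_variational (u v : H1 D) : minimizer K u -> K v ->
  \int[leb]_(x in D) (enorm (grad u x) ^+ 2) <=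
  \int[leb]_(x in D) dotv (grad u x) (grad v x).
Proof.
move=> [Ku umin] Kv.
set U := \int[leb]_(x in D) (enorm (grad u x) ^+ 2).
set P := \int[leb]_(x in D) dotv _ _.
pose V := \int[leb]_(x in D) (enorm (grad v x) ^+ 2).
have key s : 0 <= s <= 1 -> U <= (1 - s) ^+ 2 * U + 2 * (1 - s) * s * P + s ^+ 2 * V.
  move=> s01; have := umin _ (admissible_convex s01 Ku Kv).
  rewrite !energy_fin lee_fin ler_pM2l ?invr_gt0//= energy_lin//; exact: grad_L2.
rewrite leNgt; apply/negP => PU.
(* With [s E = U - P], the quadratic term [s^2 (U - 2 P + V)] is at most half
   of the linear term [2 s (U - P)]. *)
pose E := `|U - 2 * P + V| + (U - P).
have E0 : 0 < E by rewrite ltr_wpDl// subr_gt0.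
pose s := (U - P) / E.
have s0 : 0 < s by rewrite divr_gt0// subr_gt0.
have s1 : s <= 1 by rewrite ler_pdivrMr// mul1r lerDr.
have /key : 0 <= s <= 1 by rewrite ltW.
have sE : s * E = U - P by rewrite mulfVK// gt_eqF.
have : s * (U - 2 * P + V) <= U - P.
  rewrite -sE ler_pM2l// (le_trans (ler_norm _))// lerDl subr_ge0 ltW//.
rewrite -(ler_pM2l s0) => H1 H2.
have : 0 < s * (U - P) by rewrite mulr_gt0// subr_gt0.
nra.
Qed.

(** The difference of two traces of [v] is a trace of [v - v], whose gradient
   vanishes and which is in [H^1_0] because [v] has a boundary trace. *)
Lemma trace_unique D' C (v : H1 D) g g' : trace_const D M D' C -> K v ->
  is_trace (M `&` D) v g -> is_trace (M `&` D) v g' ->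
  {ae surf, forall x, (M `&` D) x -> g x = g' x}.
Proof.
move=> [C0 trC] Kv tg tg'.
have z0 := admissible_sub_H10 Kv Kv.
have tz := trace_lin oD 1 (-1) mG tg tg'.
have := trC _ _ z0 tz.
rewrite [X in (_ * X)%E](_ : _ = 0%E); last first.
  rewrite L2normE integral0_eq ?poweR0r// => x _.
  rewrite /= scale1r scaleN1r subrr /enorm big1 ?sqrtr0 ?expr0n// => i _.
  by rewrite mxE expr0n.
rewrite mule0 => N0.
have {}N0 : L2norm surf (M `&` D) (fun x => 1 * g x + -1 * g' x) = 0%E.
  by apply/eqP; rewrite eq_le N0 L2norm_ge0.
case: tz => /(L2P _ _ mG)[mz _] _.
have z_ae := L2norm_eq0 mG mz N0.
apply: (ae_imp2 z_ae z_ae) => x + _ Gx => /(_ Gx)/eqP.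
by rewrite mul1r mulN1r subr_eq0 => /eqP.
Qed.

End variational.

(** * The error estimate *)

(** If [x] exceeded [A + sqrt s], then both [x] and [x - A] would exceed
   [sqrt s], and [x (x - A)] would exceed [s]. *)
Lemma quadratic_bound (R : rcfType) (x A s : R) : 0 <= A -> 0 <= s ->
  x ^+ 2 <= A * x + s -> x <= A + Num.sqrt 2 * Num.sqrt s.
Proof.
move=> A0 s0 H; rewrite leNgt; apply/negP => xA.
have r2 : Num.sqrt s <= Num.sqrt 2 * Num.sqrt s.
  rewrite ler_peMl ?sqrtr_ge0// -[X in X <= _]sqrtr1 ler_wsqrtr//; lra.
have r0 := sqrtr_ge0 s; have rs := sqr_sqrtr s0.
nra.
Qed.

Section estimate.
Context (R : realType) (n : nat) (D Dp Dm M : set 'rV[R]_n) (psi phi : 'rV[R]_n -> R).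
Hypotheses (oD : open D) (oDp : open Dp) (oDm : open Dm).
Hypotheses (DpD : Dp `<=` D) (DmD : Dm `<=` D).
Local Notation lebT := (caratheodory_type (lebesgue_outer (R:=R) n)).
Local Notation surfT := (caratheodory_type (hausdorff_outer (R:=R) n n.-1)).
Hypothesis mG : measurable (M `&` D : set surfT).
Local Notation K := (admissible (D := D) M psi phi).
Local Notation G := (M `&` D).
Local Notation N2 f := (fine (L2norm leb D (fun x => enorm (f x)))).

Let mD : measurable (D : set lebT). Proof. exact: open_leb. Qed.

Lemma subdomain_bound (D' : set 'rV[R]_n) (C : R) (w : H1 D) (f : 'rV[R]_n -> R) :
  open D' -> D' `<=` D -> friedrichs_const D D' C -> H10 w -> L2 leb D' f ->
  `|\int[leb]_(x in D') (f x * w x)| <=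
    C * fine (L2norm leb D' f) * N2 (grad w).
Proof.
move=> oD' D'D [C0 FC] w0 f2.
have mD' : measurable (D' : set lebT) by exact: open_leb.
have w2 : L2 leb D' w := L2_subset mD mD' D'D (H1fun_L2 w).
have e2 := L2vec_enorm mD (grad_L2 w).
rewrite -lee_fin; apply: le_trans (L2_cauchy_schwarz mD' f2 w2) _.
rewrite !EFinM !fineK ?L2norm_fin// -muleA [leRHS]muleCA.
apply: lee_wpmul2l; first exact: L2norm_ge0.
apply: le_trans (FC w w0) _; apply: lee_wpmul2l; first by rewrite lee_fin.
by apply: L2norm_subset => //; case/(L2P _ _ mD): e2.
Qed.

Lemma trace_bound (D' : set 'rV[R]_n) (C : R) (w : H1 D) (g f : 'rV[R]_n -> R) :
  open D' -> D' `<=` D -> trace_const D M D' C -> H10 w -> is_trace G w g ->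
  L2 surf G f ->
  `|\int[surf]_(x in G) (f x * g x)| <=
    C * fine (L2norm surf G f) * N2 (grad w).
Proof.
move=> oD' D'D [C0 TC] w0 tg f2.
have mD' : measurable (D' : set lebT) by exact: open_leb.
have g2 : L2 surf G g by case: tg.
have e2 := L2vec_enorm mD (grad_L2 w).
rewrite -lee_fin; apply: le_trans (L2_cauchy_schwarz mG f2 g2) _.
rewrite !EFinM !fineK ?L2norm_fin// -muleA [leRHS]muleCA.
apply: lee_wpmul2l; first exact: L2norm_ge0.
apply: le_trans (TC w g w0 tg) _; apply: lee_wpmul2l; first by rewrite lee_fin.
by apply: L2norm_subset => //; case/(L2P _ _ mD): e2.
Qed.

(** [|grad w|^2 = grad v . grad w - grad u . grad w], and the last integral is
   nonnegative by the variational inequality. *)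
Lemma grad_diff_le (u v : H1 D) : minimizer K u -> K v ->
  N2 (grad (H1_lin oD 1 (-1) v u)) ^+ 2 <=
  \int[leb]_(x in D) dotv (grad v x) (grad (H1_lin oD 1 (-1) v u) x).
Proof.
move=> umin Kv; set w := H1_lin _ _ _ _ _.
rewrite (L2norm_sqr (L2vec_enorm mD (grad_L2 w))) energy_lin//; try exact: grad_L2.
have := minimizer_variational oD mG umin Kv.
have -> : \int[leb]_(x in D) dotv (grad v x) (grad w x) =
    \int[leb]_(x in D) (enorm (grad v x) ^+ 2) -
    \int[leb]_(x in D) dotv (grad v x) (grad u x).
  have vvi : (@leb R n).-integrable D (EFin \o (fun x => enorm (grad v x) ^+ 2)).
    have := dotv_integrable mD (grad_L2 v) (grad_L2 v).
    by apply: eq_integrable => // x _ /=; rewrite dotvv.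
  rewrite -(RintegralB mD vvi (dotv_integrable mD (grad_L2 v) (grad_L2 u))).
  apply: eq_Rintegral => x _.
  by rewrite /= dotvC dotv_lin mul1r mulN1r dotvv (dotvC (grad u x)).
have -> : \int[leb]_(x in D) dotv (grad u x) (grad v x) =
    \int[leb]_(x in D) dotv (grad v x) (grad u x).
  by apply: eq_Rintegral => x _; rewrite dotvC.
lra.
Qed.

(** Integration by parts of [q] against [w] on the two subdomains.  For [D'] one
   takes the subdomain with the smaller trace constant. *)
Lemma flux_bound (CFp CFm C : R) D' (w : H1 D) (wM lambda : 'rV[R]_n -> R)
    (v : H1 D) (q : Hdiv D Dp Dm M) :
  friedrichs_const D Dp CFp -> friedrichs_const D Dm CFm ->
  open D' -> D' `<=` D -> trace_const D M D' C ->
  H10 w -> is_trace G w wM -> L2 surf G lambda ->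
  \int[leb]_(x in D) dotv (grad v x) (grad w x) <=
  (N2 (fun x => grad v x - q x) + CFp * fine (L2norm leb Dp (divplus q))
   + CFm * fine (L2norm leb Dm (divminus q))
   + C * fine (L2norm surf G (fun x => lambda x - jump q x))) * N2 (grad w)
  + \int[surf]_(x in G) (lambda x * wM x).
Proof.
move=> Fp Fm oD' D'D TC w0 tw l2.
have gw2 := grad_L2 w; have gv2 := grad_L2 v; have q2 := flux_L2 q.
have vq2 : L2vec D (fun x => grad v x - q x).
  have := L2vec_lin 1 (-1) mD gv2 q2.
  by under eq_fun do rewrite scale1r scaleN1r.
have wM2 : L2 surf G wM by case: tw.
have lj2 : L2 surf G (fun x => lambda x - jump q x).
  have := @L2_lin _ surfT _ surf G 1 (-1) _ _ mG l2 (jump_L2 q).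
  by under eq_fun do rewrite mul1r mulN1r.
have split_v : \int[leb]_(x in D) dotv (grad v x) (grad w x) =
    \int[leb]_(x in D) dotv (grad v x - q x) (grad w x) +
    \int[leb]_(x in D) dotv (q x) (grad w x).
  rewrite -(RintegralD mD (dotv_integrable mD vq2 gw2) (dotv_integrable mD q2 gw2)).
  apply: eq_Rintegral => x _.
  have E : grad v x = 1 *: (grad v x - q x) + 1 *: q x.
    by rewrite !scale1r subrK.
  by rewrite {1}E dotv_lin !mul1r.
have split_j : \int[surf]_(x in G) (jump q x * wM x) =
    \int[surf]_(x in G) (lambda x * wM x) -
    \int[surf]_(x in G) ((lambda x - jump q x) * wM x).
  rewrite -(RintegralB mG (L2_mul_integrable mG l2 wM2) (L2_mul_integrable mG lj2 wM2)).
  by apply: eq_Rintegral => x _; ring.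
have b1 := dotv_cauchy_schwarz mD vq2 gw2.
have {}b1 : `|\int[leb]_(x in D) dotv (grad v x - q x) (grad w x)| <=
    N2 (fun x => grad v x - q x) * N2 (grad w).
  by rewrite -lee_fin EFinM !fineK// L2norm_fin//; exact: L2vec_enorm.
have b2 := subdomain_bound oDp DpD Fp w0 (divplus_L2 q).
have b3 := subdomain_bound oDm DmD Fm w0 (divminus_L2 q).
have b4 := trace_bound oD' D'D TC w0 tw lj2.
have := jumpP q w0 tw; rewrite split_j split_v.
move: b1 b2 b3 b4; rewrite !ler_norml.
move=> /andP[_ b1] /andP[b2 _] /andP[b3 _] /andP[b4 _].
lra.
Qed.

End estimate.

Unset Implicit Arguments.

Theorem theorem2p4 (R : realType) (n : nat)
    (Omega Omegap Omegam M : set 'rV[R]_n.+1) (psi phi : 'rV[R]_n.+1 -> R)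
    (CFp CFm CTrp CTrm : R) (u : H1 Omega) :
  lipschitz_domain Omega ->
  smooth_hypersurface M ->
  divides M Omega Omegap Omegam ->
  smooth_on M psi ->
  Hhalf (boundary Omega) phi ->
  (forall x, M x -> boundary Omega x -> psi x <= phi x) ->
  friedrichs_const Omega Omegap CFp ->
  friedrichs_const Omega Omegam CFm ->
  trace_const Omega M Omegap CTrp ->
  trace_const Omega M Omegam CTrm ->
  minimizer (admissible M psi phi) u ->
  forall (v : H1 Omega) (vM : 'rV[R]_n.+1 -> R) (lambda : 'rV[R]_n.+1 -> R)
         (q : Hdiv Omega Omegap Omegam M),
    admissible M psi phi v ->
    is_trace (M `&` Omega) v vM ->
    Lambda Omega M lambda ->
    (L2norm leb Omega (fun x => enorm (grad v x - grad u x)%R) <=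
       L2norm leb Omega (fun x => enorm (grad v x - q x)%R)
       + (Num.sqrt 2)%:E *
         (\int[surf]_(x in M `&` Omega) (lambda x * (vM x - psi x))%:E) `^ 2^-1
       + CFp%:E * L2norm leb Omegap (divplus q)
       + CFm%:E * L2norm leb Omegam (divminus q)
       + (Num.min CTrp CTrm)%:E *
         L2norm surf (M `&` Omega) (fun x => (lambda x - jump q x)%R))%E.
Proof.
move=> [oD _ _ _ _] _ [[oDp _ _ _ _] [oDm _ _ _ _] _ DM _] _ _ _.
move=> Fp Fm Tp Tm umin v vM lambda q Kv tv [l2 l0].
have DpD : Omegap `<=` Omega.
  by move=> x Dpx; have [] : (Omega `\` M) x by rewrite DM; left.
have DmD : Omegam `<=` Omega.
  by move=> x Dmx; have [] : (Omega `\` M) x by rewrite DM; right.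
pose surfT := caratheodory_type (hausdorff_outer (R:=R) n.+1 n.+1.-1).
have mG : measurable (M `&` Omega : set surfT).
  have -> : M `&` Omega = Omega `\` (Omegap `|` Omegam).
    by rewrite -DM setDD setIC.
  apply: (@measurableD _ surfT); first exact: open_surf.
  by apply: open_surf; exact: openU.
have [D' [oD' D'D TC]] : exists D', [/\ open D', D' `<=` Omega &
    trace_const Omega M D' (Num.min CTrp CTrm)].
  by case: (leP CTrp CTrm) => _; [exists Omegap|exists Omegam].
have [[uM tu pu] _] := umin.1; have [[g tg pg] _] := Kv.
have vg := trace_unique oD mG Tp Kv tv tg.
pose w := H1_lin oD 1 (-1) v u.
pose wM x := 1 * vM x + -1 * uM x.
have tw : is_trace (M `&` Omega) w wM := trace_lin oD 1 (-1) mG tv tu.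
have w0 : H10 w := admissible_sub_H10 oD Kv umin.1.
have wM2 : L2 surf (M `&` Omega) wM by case: tw.
have := le_trans (grad_diff_le oD mG umin Kv)
  (flux_bound oD oDp oDm DpD DmD mG v q Fp Fm oD' D'D TC w0 tw l2).
have -> : L2norm leb Omega (fun x => enorm (grad v x - grad u x)) =
    L2norm leb Omega (fun x => enorm (grad w x)).
  by apply: eq_L2norm => x _; rewrite /= scale1r scaleN1r.
have lwi := L2_mul_integrable mG l2 wM2.
have vpsi := ae_imp2 vg pg
  (fun x e p Gx => eq_ind_r (fun y => psi x <= y) (p Gx) (e Gx)).
have lvpsi : {ae surf, forall x, (M `&` Omega) x -> 0 <= lambda x * (vM x - psi x)}.
  apply: (ae_imp2 vpsi l0) => x {}pv {}l0 Gx.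
  by rewrite mulr_ge0 ?l0// subr_ge0 pv.
have IS : ((\int[surf]_(x in M `&` Omega) (lambda x * wM x))%:E <=
    \int[surf]_(x in M `&` Omega) (lambda x * (vM x - psi x))%:E)%E.
  rewrite /Rintegral fineK; last exact: integrable_fin_num.
  apply: ae_le_integral => //.
  apply: (ae_imp2 pu l0) => x {}pu {}l0 Gx.
  by rewrite /wM mul1r mulN1r ler_wpM2l ?l0// lerD2l lerN2 pu.
have S0 : (0 <= \int[surf]_(x in M `&` Omega) (lambda x * (vM x - psi x))%:E)%E.
  rewrite -[leLHS](@integral0 _ surfT _ surf (M `&` Omega)).
  by apply: (ae_le_integral (f := cst 0)) => //; exact: integrable0.
move: IS S0; set S := (\int[surf]_(x in _) _%:E)%E; set I := Rintegral _ _ _.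
have mO := open_leb oD.
have gw2 := L2vec_enorm mO (grad_L2 w).
have vq2 : L2 leb Omega (fun x => enorm (grad v x - q x)).
  apply: L2vec_enorm => //.
  have := L2vec_lin 1 (-1) mO (grad_L2 v) (flux_L2 q).
  by under eq_fun do rewrite scale1r scaleN1r.
have lj2 : L2 surf (M `&` Omega) (fun x => lambda x - jump q x).
  have := @L2_lin _ surfT _ surf _ 1 (-1) _ _ mG l2 (jump_L2 q).
  by under eq_fun do rewrite mul1r mulN1r.
have dp2 := divplus_L2 q; have dm2 := divminus_L2 q.
rewrite -(fineK (L2norm_fin gw2)) -(fineK (L2norm_fin vq2)).
rewrite -(fineK (L2norm_fin lj2)) -(fineK (L2norm_fin dp2)).
rewrite -(fineK (L2norm_fin dm2)) /=.
set N := fine _; set a := fine _; set dp := fine _; set dm := fine _; set j := fine _.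
have a0 : 0 <= a by rewrite fine_ge0// L2norm_ge0.
have j0 : 0 <= j by rewrite fine_ge0// L2norm_ge0.
have dp0 : 0 <= dp by rewrite fine_ge0// L2norm_ge0.
have dm0 : 0 <= dm by rewrite fine_ge0// L2norm_ge0.
have Cp0 := Fp.1; have Cm0 := Fm.1; have C0 := TC.1.
(* If [S] is infinite, so is the right-hand side. *)
case: S => [s| |] //; last first.
  move=> _ _ _; rewrite poweRyr// gt0_muley ?lte_fin ?sqrtr_gt0//.
  by rewrite addey// !addye// leey.
rewrite !lee_fin => Is s0 main.
rewrite powR12_sqrt//.
have := @quadratic_bound _ N (a + CFp * dp + CFm * dm + Num.min CTrp CTrm * j) s.
move=> /(_ _ s0) bound.
apply: le_trans (bound _ _) _.
- by rewrite !addr_ge0 ?mulr_ge0.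
- by apply: le_trans main _; rewrite lerD2l.
- lra.
Qed.
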